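(* Let $V$ be a Hilbert space of finite dimension $d\ge2$ and let $R$ be an involutive reducible R-matrix on $V$. Then $R$ is restrictable. More precisely, there exists a nontrivial subspace $W\subset V$ (with orthogonal complement $W^\perp$) such that, according to the orthogonal decomposition $$V\otimes V=(W\otimes W)\oplus(W\otimes W^\perp)\oplus(W^\perp\otimes W)\oplus(W^\perp\otimes W^\perp),$$ $R$ takes the form $$R=\begin{pmatrix}S&0&0&0\\0&0&U^{-1}&0\\0&U&0&0\\0&0&0&T\end{pmatrix}$$ with a unitary $U:W\otimes W^\perp\to W^\perp\otimes W$ and involutive R-matrices $S$ on $W$ and $T$ on $W^\perp$.
   Context: An R-matrix on a finite-dimensional Hilbert space $V$ is a unitary $R$ on $V\otimes V$ with $(R\otimes1)(1\otimes R)(R\otimes1)=(1\otimes R)(R\otimes1)(1\otimes R)$; it is involutive if $R^2=1$. It is restrictable if there is a non-trivial subspace $W\subset V$ (i.e. $W\neq\{0\},V$) such that $R$ leaves both $W\otimes W$ and $W^\perp\otimes W^\perp$ invariant. Reducibility: with $d=\dim V\ge2$, let $\mathcal{O}_d$ be the Cuntz algebra generated by isometries $S_1,\dots,S_d$ with $S_i^*S_j=\delta_{ij}1$, $\sum_iS_iS_i^*=1$; let $\mathcal{F}_d^n=\mathrm{span}\{S_\mu S_\nu^*:|\mu|=|\nu|=n\}\cong M_d^{\otimes n}$, $\mathcal{F}_d=\overline{\bigcup_n\mathcal{F}_d^n}$. Identifying $V\cong\mathbb{C}^d$, $R$ is a unitary in $\mathcal{F}_d^2\cong\mathrm{End}(V\otimes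 V)$ and defines the endomorphism $\lambda_R$ of $\mathcal{O}_d$, $\lambda_R(S_i)=RS_i$. Let $\tau$ be the normalized trace on $\mathcal{F}_d$, $E^0(x)=\frac1{2\pi}\int_0^{2\pi}\lambda_{e^{it}1}(x)\,dt$, $\omega=\tau\circ E^0$, $\mathcal{M}=\pi_\omega(\mathcal{O}_d)''$ (GNS); $\lambda_R$ extends to a normal endomorphism of $\mathcal{M}$. $R$ is irreducible if $\mathcal{M}_{R,1}:=\lambda_R(\mathcal{M})'\cap\mathcal{M}=\mathbb{C}1$, and reducible otherwise. (One has $\mathcal{M}_{R,1}=\{x\in\mathcal{F}_d^1:R^*(x\otimes1)R=1\otimes x\}$ with $\mathcal{F}_d^1\cong\mathrm{End}(V)$.) *)

(* Defs.v *)
From HB Require Import structures.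
From mathcomp Require Import all_boot all_order all_algebra.
From mathcomp Require Import all_classical all_reals all_analysis.
From mathcomp Require Import complex ring.

Set Implicit Arguments.
Unset Strict Implicit.
Unset Printing Implicit Defensive.

Import Order.TTheory GRing.Theory Num.Theory Num.Def.
Import numFieldNormedType.Exports.

Local Open Scope classical_set_scope.
Local Open Scope ring_scope.

(* ** Tensor products of finite-dimensional spaces                            *)

(* An element of [tensor U W] is the matrix of its coefficients on the        *)
(* products of the reference bases [vbasis] of U and W.  These bases need not *)
(* be orthonormal.  [ox u w] is the elementary tensor; [tlift], [tmap] and    *)
(* [tassoc] are the unique linear maps with the values on elementary tensors  *)
(* given by [tliftE], [tmapE] and [tassocE].                                  *)
Section Tensor.
Variable F : fieldType.

Definition tensor (U W : vectType F) : vectType F := 'M[F]_(\dim {:U}, \dim {:W}).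

Definition ox (U W : vectType F) (u : U) (w : W) : tensor U W :=
  \matrix_(i, j) (coord (vbasis {:U}) i u * coord (vbasis {:W}) j w).

Definition rbase (U : vectType F) (i : 'I_(\dim {:U})) : U :=
  (vbasis {:U})`_i.

Definition tlift (U W X : vectType F) (b : U -> W -> X) (A : tensor U W) : X :=
  \sum_i \sum_j A i j *: b (rbase i) (rbase j).

Definition tmap (U U' W W' : vectType F) (f : U -> U') (g : W -> W') :
    tensor U W -> tensor U' W' :=
  tlift (fun u w => ox (f u) (g w)).

Definition tassoc (U V W : vectType F) :
    tensor (tensor U V) W -> tensor U (tensor V W) :=
  tlift (fun x w => tlift (fun u v => ox u (ox v w)) x).

Definition tassoc_inv (U V W : vectType F) :
    tensor U (tensor V W) -> tensor (tensor U V) W :=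
  tlift (fun u y => tlift (fun v w => ox (ox u v) w) y).

Lemma rbase_sum (U : vectType F) (u : U) :
  u = \sum_i coord (vbasis {:U}) i u *: rbase i.
Proof. exact/coord_vbasis/memvf. Qed.

Lemma tliftE (U W X : vectType F) (b : U -> W -> X) :
  (forall w, linear (b^~ w)) -> (forall u, linear (b u)) ->
  forall u w, tlift b (ox u w) = b u w.
Proof.
move=> bl br u w.
have bsumr I (r : seq I) u' (c : I -> F) (x : I -> W) :
    b u' (\sum_(i <- r) c i *: x i) = \sum_(i <- r) c i *: b u' (x i).
  elim: r => [|i r IH]; last by rewrite !big_cons br IH.
  rewrite !big_nil; have := br u' (-1) 0 0.
  by rewrite scaler0 addr0 scaleN1r addNr.
have bsuml I (r : seq I) w' (c : I -> F) (x : I -> U) :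
    b (\sum_(i <- r) c i *: x i) w' = \sum_(i <- r) c i *: b (x i) w'.
  elim: r => [|i r IH]; last by rewrite !big_cons bl IH.
  rewrite !big_nil; have := bl w' (-1) 0 0.
  by rewrite scaler0 addr0 scaleN1r addNr.
rewrite [in RHS](rbase_sum u) bsuml; apply: eq_bigr => i _.
rewrite [in RHS](rbase_sum w) bsumr scaler_sumr; apply: eq_bigr => j _.
by rewrite /ox mxE scalerA.
Qed.

Lemma ox_linear_l (U W : vectType F) (w : W) :
  linear ((@ox U W)^~ w).
Proof. by move=> a u v; apply/matrixP=> i j; rewrite !mxE linearP mulrDl mulrA. Qed.

Lemma ox_linear_r (U W : vectType F) (u : U) : linear (@ox U W u).
Proof. by move=> a v w; apply/matrixP=> i j; rewrite !mxE linearP mulrDr mulrCA. Qed.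

Lemma tlift_linear (U W X : vectType F) (b : U -> W -> X) : linear (tlift b).
Proof.
move=> a A B; rewrite /tlift scaler_sumr -big_split; apply: eq_bigr => i _ /=.
rewrite scaler_sumr -big_split; apply: eq_bigr => j _ /=.
by rewrite !mxE scalerDl scalerA.
Qed.

Lemma tmapE (U U' W W' : vectType F) (f : U -> U') (g : W -> W') :
  linear f -> linear g -> forall u w, tmap f g (ox u w) = ox (f u) (g w).
Proof.
move=> fl gl u w; rewrite /tmap tliftE // => [w'|u'] a x y.
- by rewrite fl ox_linear_l.
- by rewrite gl ox_linear_r.
Qed.

Lemma tassocE (U V W : vectType F) (u : U) (v : V) (w : W) :
  tassoc (ox (ox u v) w) = ox u (ox v w).
Proof.
have E w' u' v' : tlift (fun u v => ox u (ox v w')) (ox u' v') = ox u' (ox v' w').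
  by rewrite tliftE // => [v0|u0] a x y; rewrite ?ox_linear_l ?ox_linear_r.
rewrite /tassoc tliftE // => [w'|x] a y z; first by rewrite tlift_linear.
rewrite /tlift scaler_sumr -big_split; apply: eq_bigr => i _ /=.
rewrite scaler_sumr -big_split; apply: eq_bigr => j _ /=.
by rewrite !ox_linear_r scalerDr !scalerA mulrC.
Qed.

Lemma tassoc_invE (U V W : vectType F) (u : U) (v : V) (w : W) :
  tassoc_inv (ox u (ox v w)) = ox (ox u v) w.
Proof.
have E u' v' w' : tlift (fun v w => ox (ox u' v) w) (ox v' w') = ox (ox u' v') w'.
  by rewrite tliftE // => [v0|u0] a x y; rewrite ?ox_linear_r ?ox_linear_l.
rewrite /tassoc_inv tliftE // => [x|u'] a y z; last by rewrite tlift_linear.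
rewrite /tlift scaler_sumr -big_split; apply: eq_bigr => i _ /=.
rewrite scaler_sumr -big_split; apply: eq_bigr => j _ /=.
by rewrite !ox_linear_l scalerDr !scalerA mulrC.
Qed.

End Tensor.


Section HilbertTensor.
Variable R : realType.
Local Notation C := R[i].

(* The inner product of U ⊗ W determined by                                   *)
(* <u ⊗ w, u' ⊗ w'> = <u, u'> <w, w'>, see [tdotE]; as in {dot _ for _},      *)
(* forms are linear in the first variable and conjugate-linear in the second. *)
Definition tdot (U W : vectType C) (f : U -> U -> C) (g : W -> W -> C)
    (A B : tensor U W) : C :=
  \sum_i \sum_j \sum_k \sum_l
    A i j * conjC (B k l) * (f (rbase i) (rbase k) * g (rbase j) (rbase l)).

Lemma tdotE (U W : vectType C) (f : {dot U for conjC}) (g : {dot W for conjC})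
    (u u' : U) (w w' : W) :
  tdot f g (ox u w) (ox u' w') = f u u' * g w w'.
Proof.
have E (X : vectType C) (h : {dot X for conjC}) x x' : h x x' =
    \sum_i \sum_k coord (vbasis {:X}) i x * conjC (coord (vbasis {:X}) k x')
                  * h (rbase i) (rbase k).
  rewrite [in LHS](rbase_sum x) linear_sumlz; apply: eq_bigr => i _.
  rewrite linearZl_LR /= [in LHS](rbase_sum x') linear_sumr mulr_sumr.
  by apply: eq_bigr => k _; rewrite linearZr_LR /= mulrA.
rewrite (E _ f) (E _ g) mulr_suml; apply: eq_bigr => i _.
rewrite mulr_sumr; apply: eq_bigr => j _.
rewrite mulr_suml; apply: eq_bigr => k _.
rewrite mulr_sumr; apply: eq_bigr => l _.
rewrite !mxE rmorphM /=; ring.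
Qed.

(* ** R-matrices                                                              *)

Definition unitary (X Y : vectType C) (f : X -> X -> C) (g : Y -> Y -> C)
    (u : 'Hom(X, Y)) : Prop :=
  (forall x x', g (u x) (u x') = f x x') /\ (forall y, exists x, u x = y).

Definition yang_baxter (V : vectType C) (T : 'End(tensor V V)) : Prop :=
  let T12 : tensor (tensor V V) V -> tensor (tensor V V) V := tmap T id in
  let T23 := @tassoc_inv _ V V V \o tmap id T \o @tassoc _ V V V in
  T12 \o T23 \o T12 = T23 \o T12 \o T23.

Definition Rmatrix (V : vectType C) (f : V -> V -> C)
    (T : 'End(tensor V V)) : Prop :=
  unitary (tdot f f) (tdot f f) T /\ yang_baxter T.

Definition involutiveR (V : vectType C) (T : 'End(tensor V V)) : Prop :=
  (T \o T)%VF = \1%VF.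

Definition subtensor (V : vectType C) (W1 W2 : {vspace V}) :
    {vspace tensor V V} :=
  <<[seq ox u v | u <- vbasis W1, v <- vbasis W2]>>%VS.

Definition nontrivial (V : vectType C) (W : {vspace V}) : Prop :=
  W <> 0%VS /\ W <> fullv.

Definition restrictable (V : vectType C) (f : {dot V for conjC})
    (T : 'End(tensor V V)) : Prop :=
  exists W : {vspace V}, let W' := orthov f W in
  [/\ nontrivial W,
      (T @: subtensor W W <= subtensor W W)%VS &
      (T @: subtensor W' W' <= subtensor W' W')%VS].

Definition subform (V : vectType C) (f : V -> V -> C) (W : {vspace V})
    (x y : subvs_of W) : C := f (vsval x) (vsval y).

Definition tincl (V : vectType C) (W1 W2 : {vspace V}) :
    tensor (subvs_of W1) (subvs_of W2) -> tensor V V :=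
  tmap vsval vsval.

(* The block form of T with respect to the decomposition                      *)
(* (W ⊗ W) ⊕ (W ⊗ W') ⊕ (W' ⊗ W) ⊕ (W' ⊗ W'), column by column.               *)
Definition block_form (V : vectType C) (W W' : {vspace V})
    (T : 'End(tensor V V))
    (S1 : 'End(tensor (subvs_of W) (subvs_of W)))
    (T1 : 'End(tensor (subvs_of W') (subvs_of W')))
    (U : 'Hom(tensor (subvs_of W) (subvs_of W'),
              tensor (subvs_of W') (subvs_of W))) : Prop :=
  [/\ forall x, T (tincl x) = tincl (S1 x),
      forall x : tensor (subvs_of W) (subvs_of W'),
        T (tincl x) = tincl (U x),
      forall x : tensor (subvs_of W') (subvs_of W),
        T (tincl x) = tincl ((U^-1)%VF x) &
      forall x, T (tincl x) = tincl (T1 x)].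

End HilbertTensor.

(* ** C*-algebras and the Cuntz algebra                                       *)

(* The norm takes its values in R[i], as in [normedModType R[i]].             *)
Record cstarAlg (R : realType) := CstarAlg {
  cs_alg :> algType R[i];
  star : cs_alg -> cs_alg;
  cnorm : cs_alg -> R[i];
  starK : involutive star;
  starD : forall x y, star (x + y) = star x + star y;
  starZ : forall a x, star (a *: x) = conjC a *: star x;
  starM : forall x y, star (x * y) = star y * star x;
  cnorm0_eq0 : forall x, cnorm x = 0 -> x = 0;
  cnormD : forall x y, cnorm (x + y) <= cnorm x + cnorm y;
  cnormZ : forall a x, cnorm (a *: x) = `|a| * cnorm x;
  cnormM : forall x y, cnorm (x * y) <= cnorm x * cnorm y;
  cnorm_star : forall x, cnorm (star x * x) = cnorm x ^+ 2;
  cs_complete : forall u : nat -> cs_alg,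
    (forall e : R[i], 0 < e -> exists N, forall m n, (N <= m)%N -> (N <= n)%N ->
       cnorm (u m - u n) < e) ->
    exists l, forall e : R[i], 0 < e -> exists N, forall n, (N <= n)%N ->
       cnorm (u n - l) < e
}.

Section Cstar.
Variables (R : realType) (A : cstarAlg R).
Local Notation C := R[i].

Definition cs_closure (X : set A) : set A :=
  [set x | forall e : C, 0 < e -> exists2 y, X y & cnorm (x - y) < e].

Definition generates (I : Type) (S : I -> A) : Prop :=
  forall X : set A, (forall i, X (S i)) ->
    (forall (a : C) x y, X x -> X y -> X (a *: x + y)) ->
    (forall x y, X x -> X y -> X (x * y)) ->
    (forall x, X x -> X (star x)) ->
    cs_closure X `<=` X -> X = setT.

Definition star_endo (h : A -> A) : Prop :=
  [/\ linear h, h 1 = 1, (forall x y, h (x * y) = h x * h y) &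
      forall x, h (star x) = star (h x)].

Definition riemann_integral (g : R -> A) (a b : R) (I : A) : Prop :=
  forall e : C, 0 < e -> exists2 delta : R, 0 < delta &
    forall (n : nat) (t s : nat -> R), t 0%N = a -> t n = b ->
      (forall i, (i < n)%N ->
         [/\ t i <= s i, s i <= t i.+1 & t i.+1 - t i < delta]) ->
      cnorm (\sum_(i < n) (t i.+1 - t i)%:C%C *: g (s i) - I) < e.

Variable d : nat.

Definition cuntz_family (S : 'I_d -> A) : Prop :=
  [/\ (forall i j, star (S i) * S j = (i == j)%:R),
      \sum_i S i * star (S i) = 1 &
      generates S].

Variable S : 'I_d -> A.

Definition word n (mu : n.-tuple 'I_d) : A := \prod_(i <- mu) S i.

Definition Fcore_n n : set A :=
  [set x | exists c : n.-tuple 'I_d -> n.-tuple 'I_d -> C,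
     x = \sum_mu \sum_nu c mu nu *: (word mu * star (word nu))].

Definition Fcore : set A := cs_closure (\bigcup_n Fcore_n n).

Definition normalized_trace (tau : A -> C) : Prop :=
  [/\ (forall (a : C) x y, Fcore x -> Fcore y ->
         tau (a *: x + y) = a * tau x + tau y),
      (forall x, Fcore x -> 0 <= tau (star x * x)),
      tau 1 = 1 &
      (forall x y, Fcore x -> Fcore y -> tau (x * y) = tau (y * x))].

Definition cuntz_endo (u : A) (h : A -> A) : Prop :=
  star_endo h /\ forall i, h (S i) = u * S i.

Definition expi (t : R) : C := (cos t +i* sin t)%C.

(* E0 x = 1/(2 pi) * integral over [0, 2 pi] of lambda_{e^{it} 1}(x) dt.      *)
Definition gauge_expectation (E0 : A -> A) : Prop :=
  exists2 gam : R -> A -> A,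
    (forall t, cuntz_endo ((expi t)%:A) (gam t)) &
    forall x, riemann_integral (gam^~ x) 0 (2 * pi) ((2 * pi)%:C%C *: E0 x).

End Cstar.

(* ** Hilbert spaces and von Neumann algebras                                 *)

Record hilbert (R : realType) := Hilbert {
  hs :> completeNormedModType R[i];
  ip : {dot hs for conjC};
  ip_norm : forall x, ip x x = `|x| ^+ 2
}.

Section VonNeumann.
Variables (R : realType) (H : hilbert R).
Local Notation C := R[i].

Definition bounded_op (T : H -> H) : Prop :=
  linear T /\ exists K : C, forall x, `|T x| <= K * `|x|.

Definition commutant (X : set (H -> H)) : set (H -> H) :=
  [set T | bounded_op T /\ forall Y, X Y -> T \o Y = Y \o T].

Definition adjoint_op (T T' : H -> H) : Prop :=
  forall x y, ip H (T x) y = ip H x (T' y).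

Definition op_le (T T' : H -> H) : Prop :=
  forall x, 0 <= ip H (T' x - T x) x.

Variable M : set (H -> H).

(* The order and suprema of increasing nets are used to express normality;    *)
(* the behaviour of an endomorphism h outside of M is irrelevant.             *)

Definition is_sup (D : set (H -> H)) (s : H -> H) : Prop :=
  [/\ M s, (forall T, D T -> op_le T s) &
      forall u, M u -> (forall T, D T -> op_le T u) -> op_le s u].

Definition vN_endo (h : (H -> H) -> (H -> H)) : Prop :=
  [/\ (forall T, M T -> M (h T)),
      (forall (a : C) T T', M T -> M T' ->
         h (fun x => a *: T x + T' x) = (fun x => a *: h T x + h T' x)),
      (forall T T', M T -> M T' -> h (T \o T') = h T \o h T'),
      h id = id &
      (forall T T', M T -> M T' -> adjoint_op T T' ->
         adjoint_op (h T) (h T'))].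

Definition normal_map (h : (H -> H) -> (H -> H)) : Prop :=
  forall (D : set (H -> H)) (s : H -> H),
    D `<=` M -> D !=set0 ->
    (forall T, D T -> op_le (fun=> 0) T) ->
    (forall T T', D T -> D T' ->
       exists T'', [/\ D T'', op_le T T'' & op_le T' T'']) ->
    is_sup D s -> is_sup (h @` D) (h s).

Definition scalar_ops : set (H -> H) :=
  [set T | exists c : C, T = fun x => c *: x].

End VonNeumann.

(* Boundedness of pi is automatic for *-representations of C*-algebras.       *)
Definition star_rep (R : realType) (A : cstarAlg R) (H : hilbert R)
    (pi : A -> H -> H) : Prop :=
  [/\ (forall x, linear (pi x)),
      (forall x v, `|pi x v| <= cnorm x * `|v|),
      (forall (a : R[i]) x y v, pi (a *: x + y) v = a *: pi x v + pi y v),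
      (pi 1 = id /\ forall x y, pi (x * y) = pi x \o pi y) &
      forall x, adjoint_op (pi x) (pi (star x))].

Definition is_gns (R : realType) (A : cstarAlg R) (omega : A -> R[i])
    (H : hilbert R) (pi : A -> H -> H) (Omega : H) : Prop :=
  [/\ star_rep pi,
      closure [set v | exists x, v = pi x Omega] = setT &
      forall x, ip H (pi x Omega) Omega = omega x].

(* O_d with its state omega = tau o E^0 and the GNS representation of omega.  *)
(* These data are unique up to isomorphism, so quantifying over them in       *)
(* [irreducible] below involves no choice.  E0 is determined by               *)
(* [gauge_expectation], and tau is only meaningful on the core F_d.           *)
Record cuntz_gns (R : realType) (d : nat) := CuntzGns {
  Od : cstarAlg R;
  gen : 'I_d -> Od;
  genP : cuntz_family gen;
  tau : Od -> R[i];
  tauP : normalized_trace gen tau;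
  E0 : Od -> Od;
  E0P : gauge_expectation gen E0;
  gnsH : hilbert R;
  gns_pi : Od -> gnsH -> gnsH;
  gnsOmega : gnsH;
  gnsP : is_gns (tau \o E0) gns_pi gnsOmega
}.

Section Reducible.
Variables (R : realType).
Local Notation C := R[i].

Definition gnsM d (G : cuntz_gns R d) : set (gnsH G -> gnsH G) :=
  commutant (commutant (range (@gns_pi R d G))).
Arguments gnsM {d} G.

Variables (V : vectType C) (f : {dot V for conjC}).
Local Notation d := (\dim {:V}).

Definition orthonormal_basis (e : 'I_d -> V) : Prop :=
  forall i j, f (e i) (e j) = (i == j)%:R.

(* The element of F_d^2 corresponding to T under V = C^d and                  *)
(* F_d^2 = M_d ⊗ M_d, where the matrix unit E_ik ⊗ E_jl is S_i S_j S_l^* S_k^*.*)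
Definition cuntz_elem (e : 'I_d -> V) (A : cstarAlg R) (S : 'I_d -> A)
    (T : 'End(tensor V V)) : A :=
  \sum_i \sum_j \sum_k \sum_l
    tdot f f (T (ox (e k) (e l))) (ox (e i) (e j)) *:
      (S i * S j * star (S k * S l)).

(* [h] is the normal extension of lambda_T to the von Neumann algebra.        *)
Definition normal_extension (e : 'I_d -> V) (G : cuntz_gns R d)
    (T : 'End(tensor V V))
    (h : (gnsH G -> gnsH G) -> (gnsH G -> gnsH G)) : Prop :=
  [/\ vN_endo (gnsM G) h, normal_map (gnsM G) h &
      exists2 lam : Od G -> Od G,
        cuntz_endo (@gen R d G) (cuntz_elem e (@gen R d G) T) lam &
        forall x, h (gns_pi x) = gns_pi (lam x)].

(* [commutant (h @` M) `&` M] is the relative commutant of lambda_T(M) in M.  *)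
Definition irreducible (T : 'End(tensor V V)) : Prop :=
  forall (e : 'I_d -> V) (G : cuntz_gns R d)
         (h : (gnsH G -> gnsH G) -> (gnsH G -> gnsH G)),
    orthonormal_basis e -> normal_extension e T h ->
    commutant (h @` gnsM G) `&` gnsM G = @scalar_ops R (gnsH G).

Definition reducible (T : 'End(tensor V V)) : Prop := ~ irreducible T.

End Reducible.

(* Main.v *)
Require Import Defs.
From HB Require Import structures.
From mathcomp Require Import all_boot all_order all_algebra.
From mathcomp Require Import all_classical all_reals all_analysis.
From mathcomp Require Import complex.
From mathcomp Require Import ring lra zify.
Import Order.TTheory GRing.Theory Num.Theory Num.Def.
Import numFieldNormedType.Exports.
Local Open Scope ring_scope.

Set Implicit Arguments.
Unset Strict Implicit.
Unset Printing Implicit Defensive.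

(** Fix an orthonormal basis e of V and let r be the element of the Cuntz
    algebra attached to T.  Since T is unitary and squares to the identity, r is
    self-adjoint and r * r = 1.  Write w for the canonical state and
    phi x = \sum_i S i * x * star (S i).

    An operator X in the relative commutant of the image of the endomorphism
    satisfies X (r S_i) = (r S_i) X, that is phi(X) = r X r.  Right
    multiplications by monomials extend to bounded operators on the GNS space,
    they commute with the algebra and hence with X, and this turns the relation
    into one for the functional F a = <a X Om, Om> on the span of the monomials
    S_s star(S_t): F (r a r) is the average, with weight 1/d, of the
    F (star(S_i) a S_i) (lemma [commutant_twisted]).

    This relation is very rigid, because r lies in the core at level two.
    The sum of |F|^2 over the monomials with |s| = p and |t| = q does not change
    when F is composed with a |-> r a r, and the averaging divides it by d.  So
    its value at level (p + 1, q + 1) is 1/d times its value at level (p, q),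
    which is the case of equality in a Cauchy-Schwarz inequality.  Therefore, on
    the monomials of a given degree p - q, F is a |-> w (y a) for one element y
    spanned by monomials whose shorter word is a single letter, and r y r = phi(y)
    ([riesz_twisted], [twisted_comm]).  In degree 0, y lies in the span of the
    S_i star(S_j), which is a copy of End(V).

    Suppose that this copy of End(V) contains only scalar solutions of
    r y r = phi(y).  For a solution y of degree k, y star(y) and star(y) y are
    solutions of degree 0, hence scalars, and they are equal scalars if y is
    nonzero; but w multiplies by a power of d with exponent k when the two
    factors are exchanged, so that y = 0 unless k = 0.  Then F is a multiple of
    w, X is a scalar ([twisted_scalar], [commutant_scalar]) and T is
    irreducible.

    So a reducible T admits a non-scalar endomorphism X of V, which can be taken
    self-adjoint, with (X ox 1) T = T (1 ox X) ([reducible_intertwiner]).  Let W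
    be an eigenspace of X and P the orthogonal projection onto W.  As the kernel
    and the image of X - a are W and its orthogonal complement, T also
    intertwines 1 ox P with P ox 1, and conversely P ox 1 with 1 ox P because
    T is its own inverse.  Hence T maps A ox B onto B ox A whenever A and B
    are W or its complement ([tincl_block]).  The blocks of T inherit unitarity,
    the relation T T = 1 and the braid relation by restriction. *)

(** * Sums over words of a given length *)

Section Words.
Variable d : nat.
Implicit Types (s t : seq 'I_d).

(** The sum is nested, one letter at a time, so that both ends of a word can be
    peeled off: the first letter by definition, the last one by [wsum_rcons]. *)
Fixpoint wsum (Z : nmodType) (n : nat) (G : seq 'I_d -> Z) : Z :=
  if n is n'.+1 then \sum_i wsum n' (fun s => G (i :: s)) else G [::].

Lemma eq_wsum (Z : nmodType) n (G G' : seq 'I_d -> Z) :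
  (forall s, size s = n -> G s = G' s) -> wsum n G = wsum n G'.
Proof.
elim: n G G' => [|n IH] G G' E /=; first exact: E.
by apply: eq_bigr => i _; apply: IH => s ss; apply: E; rewrite /= ss.
Qed.

Lemma wsum_morph (Z Z' : nmodType) (g : Z -> Z') n G :
  g 0 = 0 -> {morph g : x y / x + y} ->
  g (wsum n G) = wsum n (fun s => g (G s)).
Proof.
move=> g0 gD; elim: n G => [|n IH] G //=.
by rewrite (big_morph g gD g0); apply: eq_bigr => i _; rewrite IH.
Qed.

Lemma wsum0 (Z : nmodType) n : wsum n (fun=> 0 : Z) = 0.
Proof. by elim: n => //= n IH; rewrite big1. Qed.

Lemma wsumD (Z : nmodType) n (G G' : seq 'I_d -> Z) :
  wsum n (fun s => G s + G' s) = wsum n G + wsum n G'.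
Proof.
elim: n G G' => [|n IH] G G' //=.
by rewrite -big_split; apply: eq_bigr => i _; rewrite IH.
Qed.

Lemma wsum_sum (Z : nmodType) n (I : finType) (G : seq 'I_d -> I -> Z) :
  wsum n (fun s => \sum_i G s i) = \sum_i wsum n (G^~ i).
Proof.
elim: n G => [|n IH] G //=.
by rewrite exchange_big; apply: eq_bigr => i _; rewrite IH.
Qed.

Lemma wsum_exchange (Z : nmodType) m n (G : seq 'I_d -> seq 'I_d -> Z) :
  wsum m (fun s => wsum n (G s)) = wsum n (fun t => wsum m (G^~ t)).
Proof.
elim: m G => [|m IH] G //=.
by rewrite wsum_sum; apply: eq_bigr => i _; rewrite IH.
Qed.

Lemma wsum_rcons (Z : nmodType) n (G : seq 'I_d -> Z) :
  wsum n.+1 G = wsum n (fun s => \sum_i G (rcons s i)).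
Proof.
elim: n G => [|n IH] G //.
by rewrite -[RHS]/(\sum_i _); apply: eq_bigr => i _; exact: (IH (fun s => G (i :: s))).
Qed.

Lemma wsum_mull (Z : pzSemiRingType) n (c : Z) (G : seq 'I_d -> Z) :
  c * wsum n G = wsum n (fun s => c * G s).
Proof. by rewrite (@wsum_morph _ _ ( *%R c)) ?mulr0 // => x y; rewrite mulrDr. Qed.

Lemma wsum_mulr (Z : pzSemiRingType) n (c : Z) (G : seq 'I_d -> Z) :
  wsum n G * c = wsum n (fun s => G s * c).
Proof. by rewrite (@wsum_morph _ _ ( *%R^~ c)) ?mul0r // => x y; rewrite mulrDl. Qed.

Lemma wsum_scale (K : pzRingType) (Z : lmodType K) n (c : K) (G : seq 'I_d -> Z) :
  c *: wsum n G = wsum n (fun s => c *: G s).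
Proof. by rewrite (@wsum_morph _ _ ( *:%R c)) ?scaler0 // => x y; rewrite scalerDr. Qed.

Lemma wsum_scalel (K : pzRingType) (Z : lmodType K) n (v : Z) (G : seq 'I_d -> K) :
  wsum n G *: v = wsum n (fun s => G s *: v).
Proof.
by apply: (wsum_morph (g := fun c => c *: v)); rewrite ?scale0r // => x y; rewrite scalerDl.
Qed.

Lemma wsum_delta (K : pzRingType) (Z : lmodType K) n s0 (G : seq 'I_d -> Z) :
  size s0 = n -> wsum n (fun s => (s == s0)%:R *: G s) = G s0.
Proof.
elim: n s0 G => [|n IH] [|j s0] G //=; first by rewrite scale1r.
move=> [ss]; rewrite (bigD1 j) //= big1 ?addr0 => [|i ij].
  rewrite -[RHS](IH s0 (fun s => G (j :: s)) ss); apply: eq_wsum => s _.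
  by rewrite eqseq_cons eqxx.
rewrite -[RHS](wsum0 Z n); apply: eq_wsum => s _.
by rewrite eqseq_cons (negbTE ij) scale0r.
Qed.

Lemma wsum_ge0 (K : numDomainType) n (G : seq 'I_d -> K) :
  (forall s, size s = n -> 0 <= G s) -> 0 <= wsum n G.
Proof.
elim: n G => [|n IH] G G0 /=; first exact: G0.
by apply: sumr_ge0 => i _; apply: IH => s ss; apply: G0; rewrite /= ss.
Qed.

Lemma wsum_eq0 (K : numDomainType) n (G : seq 'I_d -> K) :
  (forall s, size s = n -> 0 <= G s) -> wsum n G = 0 ->
  forall s, size s = n -> G s = 0.
Proof.
elim: n G => [|n IH] G G0 /= E [|i s] //= [ss].
have H0 j : 0 <= wsum n (fun s => G (j :: s)).
  by apply: wsum_ge0 => u su; apply: G0; rewrite /= su.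
apply: (IH (fun s => G (i :: s))) => // [u su|]; first by apply: G0; rewrite /= su.
have /psumr_eq0P : \sum_i wsum n (fun s => G (i :: s)) = 0 by [].
by apply=> // j _; apply: H0.
Qed.

End Words.

(** * Involution and norm of a C*-algebra *)

Section Star.
Variables (R : realType) (A : cstarAlg R).
Local Notation C := R[i].

Lemma star0 : star (0 : A) = 0.
Proof. by apply: (addrI (star (0 : A))); rewrite -starD !addr0. Qed.

Lemma star1 : star (1 : A) = 1.
Proof. by rewrite -[LHS]mul1r -{1}[1](@starK _ A) -starM mul1r starK. Qed.

Lemma starZD (a : C) (x y : A) : star (a *: x + y) = conjC a *: star x + star y.
Proof. by rewrite starD starZ. Qed.

Lemma starB (x y : A) : star (x - y) = star x - star y.
Proof. by rewrite starD -scaleN1r starZ rmorphN1 scaleN1r. Qed.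

Lemma star_sum (I : finType) (g : I -> A) : star (\sum_i g i) = \sum_i star (g i).
Proof. exact: (big_morph _ (@starD _ A) star0). Qed.

Lemma cnorm0 : cnorm (0 : A) = 0.
Proof. by rewrite -(scale0r (0 : A)) cnormZ normr0 mul0r. Qed.

Lemma cnormN (x : A) : cnorm (- x) = cnorm x.
Proof. by rewrite -scaleN1r cnormZ normrN1 mul1r. Qed.

Lemma cnorm_ge0 (x : A) : 0 <= cnorm x.
Proof.
have := cnormD x (- x); rewrite subrr cnorm0 cnormN -mulr2n.
by rewrite pmulrn_lge0.
Qed.

Lemma star_mul_eq0 (x : A) : star x * x = 0 -> x = 0.
Proof.
move=> E; apply: cnorm0_eq0; have := cnorm_star x; rewrite E cnorm0.
by move=> /esym/eqP; rewrite sqrf_eq0 => /eqP.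
Qed.

Lemma le_cnorm_star (x : A) : cnorm x <= cnorm (star x).
Proof.
have := cnorm_ge0 x; rewrite le_eqVlt => /predU1P[<-|x0]; first exact: cnorm_ge0.
by rewrite -(ler_pM2r x0) -expr2 -cnorm_star cnormM.
Qed.

Lemma cnorm_starE (x : A) : cnorm (star x) = cnorm x.
Proof. by apply/eqP; rewrite eq_le le_cnorm_star -{2}(starK x) le_cnorm_star. Qed.

End Star.

(** * Linear maps without bundled structure *)

Section LinearMaps.
Variables (K : pzRingType) (U V : lmodType K) (T : U -> V).
Hypothesis Tl : linear T.
Lemma lfD x y : T (x + y) = T x + T y.
Proof. by have := Tl 1 x y; rewrite !scale1r. Qed.
Lemma lf0 : T 0 = 0.
Proof. by apply: (addrI (T 0)); rewrite -lfD !addr0. Qed.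
Lemma lfZ a x : T (a *: x) = a *: T x.
Proof. by have := Tl a x 0; rewrite !addr0 lf0 addr0. Qed.
Lemma lfB x y : T (x - y) = T x - T y.
Proof. by rewrite lfD -scaleN1r lfZ scaleN1r. Qed.
Lemma lf_sum (I : finType) (g : I -> U) : T (\sum_i g i) = \sum_i T (g i).
Proof. exact: (big_morph _ lfD lf0). Qed.
End LinearMaps.

Section ScalarMaps.
Variables (K : fieldType) (V : lmodType K) (F : V -> K).
Hypothesis Flin : scalar F.

Lemma sfD x y : F (x + y) = F x + F y.
Proof. by have := Flin 1 x y; rewrite scale1r mul1r. Qed.

Lemma sf0 : F 0 = 0.
Proof. by apply: (addrI (F 0)); rewrite -sfD !addr0. Qed.

Lemma sfZ a x : F (a *: x) = a * F x.
Proof. by have := Flin a x 0; rewrite !addr0 sf0 addr0. Qed.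

Lemma sf_sum (I : finType) (g : I -> V) : F (\sum_i g i) = \sum_i F (g i).
Proof. exact: (big_morph _ sfD sf0). Qed.

Lemma sf_wsum d n (g : seq 'I_d -> V) : F (wsum n g) = wsum n (fun s => F (g s)).
Proof. exact: (wsum_morph _ _ sf0 sfD). Qed.
End ScalarMaps.

(** * Monomials in the generators of the Cuntz algebra *)

Section Cuntz.
Variables (R : realType) (A : cstarAlg R) (d : nat) (S : 'I_d -> A).
Local Notation C := R[i].
Hypothesis SS : forall i j, star (S i) * S j = (i == j)%:R.
Hypothesis Ssum : \sum_i S i * star (S i) = 1.
Implicit Types (s t u v : seq 'I_d) (x y z : A).

Definition wd s : A := \prod_(i <- s) S i.
Definition mon s t : A := wd s * star (wd t).

Lemma wd0 : wd [::] = 1. Proof. by rewrite /wd big_nil. Qed.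
Lemma wd_cons i s : wd (i :: s) = S i * wd s.
Proof. by rewrite /wd big_cons. Qed.
Lemma wd_cat s t : wd (s ++ t) = wd s * wd t.
Proof. by rewrite /wd big_cat. Qed.
Lemma wd_rcons s i : wd (rcons s i) = wd s * S i.
Proof. by rewrite -cats1 wd_cat wd_cons wd0 mulr1. Qed.

Lemma star_mon s t : star (mon s t) = mon t s.
Proof. by rewrite /mon starM starK. Qed.

Lemma wd_star s t : size s = size t -> star (wd s) * wd t = (s == t)%:R.
Proof.
elim: s t => [|i s IH] [|j t] //=; first by rewrite wd0 star1 mulr1.
move=> [E]; rewrite !wd_cons starM -mulrA [star (S i) * _]mulrA SS eqseq_cons.
by case: eqP => _; rewrite ?mul1r ?IH // !mul0r mulr0.
Qed.

Lemma Smon i s t : S i * mon s t = mon (i :: s) t.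
Proof. by rewrite /mon wd_cons mulrA. Qed.
Lemma monS i s t : mon s t * star (S i) = mon s (i :: t).
Proof. by rewrite /mon wd_cons starM mulrA. Qed.
Lemma starSmon i j s t : star (S i) * mon (j :: s) t = (i == j)%:R *: mon s t.
Proof.
by rewrite -Smon mulrA SS; case: eqP; rewrite ?mul1r ?scale1r // mul0r scale0r.
Qed.
Lemma monSr i j s t : mon s (j :: t) * S i = (j == i)%:R *: mon s t.
Proof.
by rewrite -monS -mulrA SS; case: eqP; rewrite ?mulr1 ?scale1r // mulr0 scale0r.
Qed.

(** Inserting 1 = \sum_i S i * star (S i) between the two words lengthens both by
    one letter; this is the embedding of level n of the core into level n + 1. *)
Lemma mon_split s t : mon s t = \sum_i mon (rcons s i) (rcons t i).
Proof.
rewrite /mon -[wd s]mulr1 -Ssum mulr_sumr mulr_suml; apply: eq_bigr => i _.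
by rewrite !wd_rcons starM !mulrA.
Qed.

Lemma mon_mul s t u v : size t = size u ->
  mon s t * mon u v = (t == u)%:R *: mon s v.
Proof.
move=> E; rewrite /mon mulrA -(mulrA (wd s)) wd_star //.
by case: eqP; rewrite ?mulr1 ?scale1r // mulr0 mul0r scale0r.
Qed.

Lemma wsum_mon n : wsum n (fun s => mon s s) = 1.
Proof.
elim: n => [|n IH]; first by rewrite /= /mon wd0 star1 mulr1.
by rewrite wsum_rcons -IH; apply: eq_wsum => s _; rewrite -mon_split.
Qed.

(** An inductive span makes a linear statement about [alg0] or [khom] an
    induction whose only content is the case of a monomial. *)
Inductive mspan (P : seq 'I_d -> seq 'I_d -> Prop) : A -> Prop :=
| mspan0 : mspan P 0
| mspanS c s t x : P s t -> mspan P x -> mspan P (c *: mon s t + x).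

(** The copy of Hom(V^(ox q), V^(ox p)) inside the Cuntz algebra; the degree of
    its elements for the gauge action is p - q. *)
Definition khom p q := mspan (fun s t => size s = p /\ size t = q).
(** The dense star-subalgebra generated by S. *)
Definition alg0 := mspan (fun _ _ => True).

Section Span.
Variable P : seq 'I_d -> seq 'I_d -> Prop.

Lemma mspan_add x y : mspan P x -> mspan P y -> mspan P (x + y).
Proof.
by elim=> [|c s t z H _ IH] py; rewrite ?add0r // -addrA; apply/mspanS/IH.
Qed.
Lemma mspan_scale c x : mspan P x -> mspan P (c *: x).
Proof.
elim=> [|a s t z H _ IH]; first by rewrite scaler0; exact: mspan0.
by rewrite scalerDr scalerA; apply: mspanS.
Qed.
Lemma mspan_mon s t : P s t -> mspan P (mon s t).
Proof. by move=> H; have := mspanS 1 H (mspan0 P); rewrite addr0 scale1r. Qed.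
Lemma mspan_sum (I : finType) (g : I -> A) :
  (forall i, mspan P (g i)) -> mspan P (\sum_i g i).
Proof. by move=> H; apply: big_ind => //; [exact: mspan0|exact: mspan_add]. Qed.
Lemma mspan_wsum n (g : seq 'I_d -> A) :
  (forall s, size s = n -> mspan P (g s)) -> mspan P (wsum n g).
Proof.
elim: n g => [|n IH] g H /=; first exact: H.
by apply: mspan_sum => i; apply: IH => s ss; apply: H; rewrite /= ss.
Qed.
End Span.

Lemma mspan_map P Q (g : A -> A) : g 0 = 0 ->
  (forall a x y, exists b, g (a *: x + y) = b *: g x + g y) ->
  (forall s t, P s t -> mspan Q (g (mon s t))) ->
  forall x, mspan P x -> mspan Q (g x).
Proof.
move=> g0 gl H x; elim=> [|a s t z Hst _ IH]; first by rewrite g0; exact: mspan0.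
have [b ->] := gl a (mon s t) z.
by apply: mspan_add => //; apply/mspan_scale/H.
Qed.
Lemma mspan_eq P (F G : A -> C) : scalar F -> scalar G ->
  (forall s t, P s t -> F (mon s t) = G (mon s t)) ->
  forall x, mspan P x -> F x = G x.
Proof.
move=> Fl Gl H x; elim=> [|a s t z Hst _ IH]; first by rewrite !sf0.
by rewrite Fl Gl H // IH.
Qed.

Lemma khom_mon s t : khom (size s) (size t) (mon s t).
Proof. exact: mspan_mon. Qed.

Lemma khom_lift n p q x : khom p q x -> khom (p + n) (q + n) x.
Proof.
elim: n p q x => [|n IH] p q x; first by rewrite !addn0.
move=> /IH; rewrite !addnS; apply: (mspan_map (g := id)) => // [a y z|s t [ss st]].
  by exists a.
by rewrite mon_split; apply: mspan_sum => i; apply: mspan_mon; rewrite !size_rcons ss st.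
Qed.

Lemma khom_star p q x : khom p q x -> khom q p (star x).
Proof.
apply: mspan_map; first exact: star0.
  by move=> a y z; exists (conjC a); rewrite starZD.
by move=> s t [? ?]; rewrite star_mon; apply: mspan_mon.
Qed.

Lemma khom_mul p q r x y : khom p q x -> khom q r y -> khom p r (x * y).
Proof.
move=> hx hy; move: hx; apply: (mspan_map (g := fun x => x * y)).
- exact: mul0r.
- by move=> a z z'; exists a; rewrite mulrDl scalerAl.
move=> s t [ss st]; move: hy; apply: (mspan_map (g := fun y => mon s t * y)).
- exact: mulr0.
- by move=> a z z'; exists a; rewrite mulrDr scalerAr.
move=> u v [su sv]; rewrite mon_mul ?st //; apply/mspan_scale/mspan_mon; by [].
Qed.

Lemma khom_SxS i p q x : khom p.+1 q.+1 x -> khom p q (star (S i) * x * S i).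
Proof.
apply: (mspan_map (g := fun x => star (S i) * x * S i)).
- by rewrite mulr0 mul0r.
- by move=> a y z; exists a; rewrite mulrDr mulrDl -scalerAr -scalerAl.
move=> [|j s] [|k t] [] //= [ss] [st].
rewrite starSmon -scalerAl monSr; do 2 apply: mspan_scale; exact: mspan_mon.
Qed.

(** The canonical endomorphism x |-> 1 ox x. *)
Definition phi x : A := \sum_i S i * x * star (S i).

Lemma phiM x y : phi (x * y) = phi x * phi y.
Proof.
rewrite /phi mulr_suml; apply: eq_bigr => i _; rewrite mulr_sumr (bigD1 i) //=.
rewrite big1 ?addr0 => [|j ji].
  by rewrite !mulrA -(mulrA _ (star (S i))) SS eqxx mulr1.
by rewrite !mulrA -(mulrA _ (star (S i))) SS eq_sym (negbTE ji) mulr0 !mul0r.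
Qed.
Lemma star_phi x : star (phi x) = phi (star x).
Proof.
by rewrite /phi star_sum; apply: eq_bigr => i _; rewrite !starM starK mulrA.
Qed.

Lemma khom_phi p q x : khom p q x -> khom p.+1 q.+1 (phi x).
Proof.
move=> hx; apply: mspan_sum => i; move: hx.
apply: (mspan_map (g := fun x => S i * x * star (S i))).
- by rewrite mulr0 mul0r.
- by move=> a y z; exists a; rewrite mulrDr mulrDl -scalerAr -scalerAl.
by move=> s t [<- <-]; rewrite Smon monS; apply: mspan_mon.
Qed.

Lemma alg0_mon s t : alg0 (mon s t). Proof. exact: mspan_mon. Qed.
Lemma khom_alg0 p q x : khom p q x -> alg0 x.
Proof.
apply: (mspan_map (g := id)) => // [a y z|s t _]; first by exists a.
exact: alg0_mon.
Qed.

Lemma alg0_S i x : alg0 x -> alg0 (S i * x).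
Proof.
apply: (mspan_map (g := fun x => S i * x)); first exact: mulr0.
  by move=> a y z; exists a; rewrite mulrDr -scalerAr.
by move=> s t _; rewrite Smon; exact: alg0_mon.
Qed.
Lemma alg0_starS i x : alg0 x -> alg0 (star (S i) * x).
Proof.
apply: (mspan_map (g := fun x => star (S i) * x)); first exact: mulr0.
  by move=> a y z; exists a; rewrite mulrDr -scalerAr.
move=> [|j s] t _; last by rewrite starSmon; apply/mspan_scale/alg0_mon.
rewrite /mon wd0 mul1r -starM -wd_rcons -[star _]mul1r -wd0; exact: alg0_mon.
Qed.
Lemma alg0_star x : alg0 x -> alg0 (star x).
Proof.
apply: mspan_map; first exact: star0.
  by move=> a y z; exists (conjC a); rewrite starZD.
by move=> s t _; rewrite star_mon; exact: alg0_mon.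
Qed.
Lemma alg0_xS i x : alg0 x -> alg0 (x * S i).
Proof. by move=> /alg0_star /(alg0_starS i) /alg0_star; rewrite starM !starK. Qed.
Lemma alg0_xstarS i x : alg0 x -> alg0 (x * star (S i)).
Proof. by move=> /alg0_star /(alg0_S i) /alg0_star; rewrite starM !starK. Qed.
Lemma alg0_mul x y : alg0 x -> alg0 y -> alg0 (x * y).
Proof.
move=> hx hy; move: hx; apply: (mspan_map (g := fun x => x * y)).
- exact: mul0r.
- by move=> a z z'; exists a; rewrite mulrDl scalerAl.
move=> s t _; rewrite /mon -mulrA; elim: s => [|i s IH].
  rewrite wd0 mul1r; elim: t y hy => [|i t IH] y hy; first by rewrite wd0 star1 mul1r.
  by rewrite wd_cons starM -mulrA; apply/IH/alg0_starS.
by rewrite wd_cons -mulrA; apply: alg0_S.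
Qed.
Lemma alg0_1 : alg0 1.
Proof. by have := alg0_mon [::] [::]; rewrite /mon wd0 star1 mulr1. Qed.
Lemma alg0_genS i : alg0 (S i).
Proof. by rewrite -[S i]mulr1; apply/alg0_S/alg0_1. Qed.

(** * The modular property of the canonical state *)

Variable w : A -> C.
Hypothesis wlin : scalar w.
Hypothesis wmon : forall s t, w (mon s t) = (s == t)%:R * d%:R ^- size s.
Hypothesis d_gt1 : (1 < d)%N.

Let dC : (d%:R : C) != 0.
Proof. by rewrite pnatr_eq0 -lt0n ltnW. Qed.

Lemma w1 : w 1 = 1.
Proof. by rewrite -[1](wsum_mon 0) /= wmon eqxx mul1r expr0 invr1. Qed.

Lemma w_nat n : w n%:R = n%:R.
Proof. by rewrite -scaler_nat (sfZ wlin) w1 mulr1. Qed.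

Lemma wA a : w a%:A = a.
Proof. by rewrite (sfZ wlin) w1 mulr1. Qed.

Lemma scalar_comp (F : A -> C) (g : A -> A) : scalar F -> linear g -> scalar (F \o g).
Proof. by move=> Fl gl a x y /=; rewrite gl Fl. Qed.

Lemma linear_mull x : linear (fun y => x * y).
Proof. by move=> a y z; rewrite mulrDr scalerAr. Qed.
Lemma linear_mulr x : linear (fun y => y * x).
Proof. by move=> a y z; rewrite mulrDl scalerAl. Qed.
Lemma linear_mullr x y : linear (fun z => x * z * y).
Proof. by move=> a u v; rewrite mulrDr mulrDl -scalerAr -scalerAl. Qed.

(** The state w is not a trace: a generator can be moved to the other side only
    at the price of a factor d.  On the core, where the numbers of generators and
    of adjoints agree, the factors cancel ([w_khom]). *)
Lemma w_S i y : alg0 y -> w (S i * y) = d%:R^-1 * w (y * S i).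
Proof.
apply: (mspan_eq (F := fun y => w (S i * y)) (G := fun y => d%:R^-1 * w (y * S i))).
- exact: (scalar_comp wlin (linear_mull _)).
- by move=> a x z; rewrite linear_mulr wlin; ring.
move=> s [|j t] _.
  by rewrite Smon wmon /mon wd0 star1 mulr1 -wd_rcons -[wd _]mulr1 -star1 -wd0
    wmon; case: s => [|? ?]; rewrite !mul0r mulr0.
rewrite Smon wmon monSr (sfZ wlin) wmon eqseq_cons eq_sym.
by case: eqP => _ /=; rewrite ?mul0r ?mulr0 //= mul1r mulrCA exprS invfM.
Qed.

Lemma w_starS i y : alg0 y -> w (star (S i) * y) = d%:R * w (y * star (S i)).
Proof.
apply: (mspan_eq (F := fun y => w (star (S i) * y)) (G := fun y => d%:R * w (y * star (S i)))).
- exact: (scalar_comp wlin (linear_mull _)).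
- by move=> a x z; rewrite linear_mulr wlin; ring.
move=> [|j s] t _; rewrite monS wmon.
  rewrite /mon wd0 mul1r -starM -wd_rcons -[star _]mul1r -wd0 wmon.
  by case: t => [|? ?]; rewrite !mul0r mulr0.
rewrite starSmon (sfZ wlin) wmon eqseq_cons eq_sym.
case: eqP => _ /=; rewrite ?mul0r ?mulr0 //= exprS invfM mul1r.
by rewrite mulrCA (mulrA d%:R) divff // mul1r.
Qed.

Lemma w_wd s y : alg0 y -> w (wd s * y) = d%:R ^- size s * w (y * wd s).
Proof.
elim: s y => [|i s IH] y hy; first by rewrite wd0 mul1r mulr1 expr0 invr1 mul1r.
have hs : alg0 (wd s * y).
  by have := alg0_mul (alg0_mon s [::]) hy; rewrite /mon wd0 star1 mulr1.
rewrite wd_cons -mulrA w_S // -mulrA IH; last exact: alg0_xS.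
by rewrite /= exprS invfM !mulrA.
Qed.

Lemma w_starwd s y : alg0 y -> w (star (wd s) * y) = d%:R ^+ size s * w (y * star (wd s)).
Proof.
elim: s y => [|i s IH] y hy; first by rewrite wd0 star1 mul1r mulr1 expr0 mul1r.
rewrite wd_cons starM -mulrA IH; last exact: alg0_starS.
rewrite -mulrA w_starS ?exprSr ?mulrA //.
by have := alg0_mul hy (alg0_mon [::] s); rewrite /mon wd0 mul1r.
Qed.

Lemma w_khom p q x y : khom p q x -> alg0 y ->
  w (x * y) = d%:R ^+ q * d%:R ^- p * w (y * x).
Proof.
move=> hx hy; move: x hx; apply: (mspan_eq (F := fun x => w (x * y))
  (G := fun x => d%:R ^+ q * d%:R ^- p * w (y * x))).
- exact: (scalar_comp wlin (linear_mulr _)).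
- by move=> a x z; rewrite linear_mull wlin; ring.
move=> s t [<- <-].
have hty : alg0 (star (wd t) * y).
  by have := alg0_mul (alg0_mon [::] t) hy; rewrite /mon wd0 mul1r.
have hys : alg0 (y * wd s).
  by have := alg0_mul hy (alg0_mon s [::]); rewrite /mon wd0 star1 mulr1.
rewrite /mon -mulrA w_wd // -mulrA w_starwd // !mulrA; congr (_ * _); exact: mulrC.
Qed.

(** Compressing by words of the right lengths extracts a matrix coefficient,
    which is read off as the value of w because w 1 = 1. *)
Lemma khom_coef p q x s t : khom p q x -> size s = p -> size t = q ->
  star (wd s) * x * wd t = (w (star (wd s) * x * wd t))%:A.
Proof.
move=> hx ss st; elim: hx => [|c u v z [su sv] _ IH].
  by rewrite mulr0 mul0r (sf0 wlin) scale0r.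
rewrite linear_mullr wlin scalerDl -scalerA -IH; congr (_ *: _ + _).
rewrite /mon mulrA wd_star ?ss ?su // -mulrA wd_star ?st ?sv //.
by rewrite -natrM w_nat scaler_nat.
Qed.

Lemma khom_col p q x t : khom p q x -> size t = q ->
  x * wd t = wsum p (fun s => w (star (wd s) * x * wd t) *: wd s).
Proof.
move=> hx st; rewrite -[x in LHS]mul1r -(wsum_mon p) !wsum_mulr.
apply: eq_wsum => s ss; rewrite /mon -[_ * x]mulrA -mulrA.
by rewrite [in LHS](khom_coef hx) // -scalerAr mulr1.
Qed.

(** By the modular property, the products with monomials compute all matrix
    coefficients of x up to nonzero factors. *)
Lemma khom_faithful p q x : khom p q x ->
  (forall a, khom q p a -> w (a * x) = 0) -> x = 0.
Proof.
move=> hx H; rewrite -[x]mulr1 -(wsum_mon q) wsum_mull.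
rewrite -[RHS](wsum0 d _ q); apply: eq_wsum => t st.
rewrite /mon mulrA (khom_col hx) // -[in RHS](mul0r (star (wd t))); congr (_ * _).
rewrite -[RHS](wsum0 d _ p); apply: eq_wsum => s ss.
have /H : khom q p (mon t s) by apply: mspan_mon.
rewrite /mon -mulrA w_wd; last first.
  by rewrite -[star _]mul1r -wd0; apply: alg0_mul (khom_alg0 hx); exact: alg0_mon.
by move/eqP; rewrite mulf_eq0 invr_eq0 expf_eq0 (negbTE dC) andbF => /eqP ->; rewrite scale0r.
Qed.

(** On the span of the words of length n, u acts as a unitary matrix on the
    left, and a unitary change of orthonormal basis preserves the norm of a
    functional. *)
Lemma norm_mull n (u : A) (G : A -> C) : khom n n u -> u * star u = 1 -> scalar G ->
  wsum n (fun t => `|G (u * wd t)| ^+ 2) = wsum n (fun t => `|G (wd t)| ^+ 2).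
Proof.
move=> hu uu Gl; pose c s t := w (star (wd s) * u * wd t).
have E t : size t = n -> G (u * wd t) = wsum n (fun s => c s t * G (wd s)).
  by move=> st; rewrite (khom_col hu) // (sf_wsum Gl); apply: eq_wsum => s _; rewrite (sfZ Gl).
have orth s s' : size s = n -> size s' = n ->
    wsum n (fun t => c s t * conjC (c s' t)) = (s == s')%:R.
  move=> ss ss'; rewrite -[LHS]wA -[RHS]w_nat -wd_star ?ss ?ss' //; congr (w _).
  have e1 : 1 = wsum n (fun t => u * mon t t * star u).
    by rewrite -wsum_mulr -wsum_mull wsum_mon mulr1 uu.
  rewrite -[wd s' in RHS]mul1r [in RHS]e1 wsum_mulr wsum_mull wsum_scalel.
  apply: eq_wsum => t st.
  have -> : (c s t * conjC (c s' t))%:A = (c s t)%:A * star ((c s' t)%:A) :> A.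
    by rewrite starZ star1 -scalerAl mul1r scalerA.
  by rewrite -(khom_coef hu) // -(khom_coef hu) // !starM starK /mon !mulrA.
under eq_wsum => t st do rewrite E // normCK.
transitivity (wsum n (fun s => wsum n (fun s' =>
    (s' == s)%:R *: (G (wd s) * conjC (G (wd s')))))).
  transitivity (wsum n (fun t => wsum n (fun s => wsum n (fun s' =>
     c s t * conjC (c s' t) * (G (wd s) * conjC (G (wd s'))))))).
    apply: eq_wsum => t st; rewrite wsum_mulr; apply: eq_wsum => s ss.
    rewrite (@wsum_morph _ _ _ conjC) ?rmorph0 //; last exact: rmorphD.
    by rewrite wsum_mull; apply: eq_wsum => s' _; rewrite rmorphM /=; ring.
  rewrite wsum_exchange; apply: eq_wsum => s ss; rewrite wsum_exchange.
  apply: eq_wsum => s' ss'; rewrite -wsum_mulr orth // eq_sym.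
  by rewrite [RHS]/GRing.scale.
by apply: eq_wsum => s ss; rewrite wsum_delta // normCK.
Qed.
(** * Functionals with the twisted invariance *)

(** Up to a power of d, the squared Hilbert-Schmidt norm of the restriction of F
    to [khom p q]. *)
Definition sqnorm (F : A -> C) p q : C :=
  wsum p (fun s => wsum q (fun t => `|F (mon s t)| ^+ 2)).

Variable r : A.
Hypothesis hr : khom 2 2 r.
Hypothesis r_star : star r = r.
Hypothesis rr : r * r = 1.

(** The relation satisfied by a |-> w (x * a) when r * x * r = phi x, but stated
    without x.  On the right is the left inverse
    x |-> d^-1 \sum_i star (S i) x (S i) of [phi]. *)
Definition twisted (F : A -> C) : Prop := forall a, alg0 a ->
  F (r * a * r) = d%:R^-1 * \sum_i F (star (S i) * a * S i).

Lemma khom_ge2 n : (2 <= n)%N -> khom n n r.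
Proof. by move=> /subnKC <-; apply: khom_lift. Qed.

(** Conjugation by r is a unitary change of basis on each side, once the words
    are long enough for r to act on them. *)
Lemma sqnorm_conj F p q : (2 <= p)%N -> (2 <= q)%N -> scalar F ->
  sqnorm (fun a => F (r * a * r)) p q = sqnorm F p q.
Proof.
move=> p2 q2 Fl; have rr' : r * star r = 1 by rewrite r_star.
transitivity (wsum p (fun s => wsum q (fun t => `|F (wd s * star (wd t) * r)| ^+ 2))).
  rewrite /sqnorm wsum_exchange [RHS]wsum_exchange; apply: eq_wsum => t _.
  have Gl : scalar (fun z => F (z * (star (wd t) * r))).
    exact: (scalar_comp Fl (linear_mulr _)).
  have := norm_mull (khom_ge2 p2) rr' Gl; rewrite -(eq_wsum (G := fun s =>
    `|F (r * mon s t * r)| ^+ 2)) => [->|s _]; last by rewrite /mon !mulrA.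
  by apply: eq_wsum => s _; rewrite /= mulrA.
rewrite /sqnorm; apply: eq_wsum => s _.
have Gl : scalar (fun z => conjC (F (wd s * star z))).
  by move=> a x y; rewrite starZD mulrDr -scalerAr Fl rmorphD rmorphM /= conjCK.
have := norm_mull (khom_ge2 q2) rr' Gl.
rewrite -(eq_wsum (G := fun t => `|F (wd s * star (wd t) * r)| ^+ 2)) => [->|t _].
  by apply: eq_wsum => t _; rewrite norm_conjC.
by rewrite norm_conjC starM r_star mulrA.
Qed.

(** Replace F by a |-> F (r * a * r), which does not change the norm; the twisted
    relation then expresses its value on a monomial by the value of F on the
    monomial without the two first letters, or by 0 if these letters differ. *)
Lemma sqnorm_step F p q : (0 < p)%N -> (0 < q)%N -> scalar F -> twisted F ->
  sqnorm F p.+1 q.+1 = d%:R^-1 * sqnorm F p q.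
Proof.
move=> p0 q0 Fl Fr; rewrite -sqnorm_conj //.
transitivity (\sum_(i < d) d%:R ^- 2 * sqnorm F p q); last first.
  rewrite sumr_const card_ord -[LHS]mulr_natl mulrA; congr (_ * _).
  by field.
apply: eq_bigr => i _; rewrite /sqnorm wsum_mull; apply: eq_wsum => s _ /=.
have E k t : F (r * mon (i :: s) (k :: t) * r) = (k == i)%:R * (d%:R^-1 * F (mon s t)).
  rewrite Fr; last exact: alg0_mon.
  rewrite (bigD1 i) //= [X in _ + X]big1 ?addr0 => [|j ji].
    by rewrite starSmon eqxx scale1r monSr (sfZ Fl) mulrCA.
  by rewrite starSmon (negbTE ji) scale0r mul0r (sf0 Fl).
rewrite (bigD1 i) //= [X in _ + X]big1 ?addr0 => [|k ki].
  rewrite wsum_mull; apply: eq_wsum => t _; rewrite E eqxx mul1r normrM exprMn.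
  by rewrite normrV ?unitfE // normr_nat -exprVn.
rewrite -[RHS](wsum0 d _ q); apply: eq_wsum => t _.
by rewrite E (negbTE ki) mul0r normr0 expr0n.
Qed.

Lemma sum_delta (a : 'I_d) (g : 'I_d -> C) : \sum_b (a == b)%:R * g b = g a.
Proof.
rewrite (bigD1 a) //= eqxx mul1r big1 ?addr0 // => b ba.
by rewrite eq_sym (negbTE ba) mul0r.
Qed.

(** The squared distance from z to the scalar matrix with the same trace; it is
    the defect in the Cauchy-Schwarz inequality for z and the identity. *)
Lemma trace_defect (z : 'I_d -> 'I_d -> C) (Z := \sum_a z a a) :
  \sum_a \sum_b `|z a b - (a == b)%:R * (Z / d%:R)| ^+ 2 =
  \sum_a \sum_b `|z a b| ^+ 2 - d%:R^-1 * `|Z| ^+ 2.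
Proof.
pose g a := z a a * conjC Z / d%:R + conjC (z a a) * Z / d%:R - Z * conjC Z / d%:R ^+ 2.
transitivity (\sum_a \sum_b (`|z a b| ^+ 2 - (a == b)%:R * g b)).
  apply: eq_bigr => a _; apply: eq_bigr => b _; rewrite !normCK rmorphB !rmorphM /=.
  rewrite fmorphV /= !conjC_nat; case: eqP => [->|_]; last by rewrite !mul0r !subr0.
  by rewrite /g !mul1r; field.
have -> : \sum_a \sum_b (`|z a b| ^+ 2 - (a == b)%:R * g b) =
    \sum_a \sum_b `|z a b| ^+ 2 - \sum_a g a.
  rewrite -sumrB; apply: eq_bigr => a _; rewrite sumrB; congr (_ - _).
  exact: sum_delta.
congr (_ - _); rewrite /g sumrB big_split /= -!mulr_suml -rmorph_sum -/Z.
rewrite sumr_const card_ord -[Z *+ d]mulr_natl normCK; by field.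
Qed.

(** By [sqnorm_step], the sum over s and t of the distances in [trace_defect]
    vanishes for the matrices F (mon (rcons s a) (rcons t b)), whose trace is
    F (mon s t) by [mon_split].  So each of these matrices is scalar. *)
Lemma twisted_rcons F s t a b : (0 < size s)%N -> (0 < size t)%N -> scalar F -> twisted F ->
  F (mon (rcons s a) (rcons t b)) = (a == b)%:R * (F (mon s t) / d%:R).
Proof.
move=> s0 t0 Fl Fr.
pose z s t a b := F (mon (rcons s a) (rcons t b)).
have FZ s' t' : F (mon s' t') = \sum_a z s' t' a a.
  by rewrite mon_split (sf_sum Fl).
pose D s t := \sum_a \sum_b `|z s t a b - (a == b)%:R * (F (mon s t) / d%:R)| ^+ 2.
have D0 s' t' : 0 <= D s' t'.
  by apply: sumr_ge0 => a' _; apply: sumr_ge0 => b' _; rewrite exprn_ge0.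
have E : wsum (size s) (fun s => wsum (size t) (D s)) = 0.
  have := sqnorm_step s0 t0 Fl Fr; rewrite /sqnorm wsum_rcons => /eqP; rewrite -subr_eq0 => /eqP <-.
  rewrite wsum_mull -mulN1r wsum_mull -wsumD; apply: eq_wsum => s' _.
  rewrite wsum_mull wsum_mull; under [X in X + _]eq_bigr => i _ do rewrite wsum_rcons.
  rewrite -wsum_sum -wsumD; apply: eq_wsum => t' _.
  by rewrite mulN1r /D FZ trace_defect.
have D00 : D s t = 0.
  have H := @wsum_eq0 d C (size s) _ (fun s' _ => wsum_ge0 (fun t' _ => D0 s' t')) E s erefl.
  exact: (wsum_eq0 (fun t' _ => D0 s t') H).
have : \sum_b `|z s t a b - (a == b)%:R * (F (mon s t) / d%:R)| ^+ 2 = 0.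
  move/psumr_eq0P: D00; apply=> // a' _.
  by apply: sumr_ge0 => b' _; rewrite exprn_ge0.
move/psumr_eq0P => /(_ (fun b' _ => exprn_ge0 2 (normr_ge0 _)) b erefl)/eqP.
by rewrite sqrf_eq0 normr_eq0 subr_eq0 => /eqP.
Qed.

Lemma twisted_cat F s t u v : (0 < size s)%N -> (0 < size t)%N -> scalar F -> twisted F ->
  size u = size v ->
  F (mon (s ++ u) (t ++ v)) = (u == v)%:R * d%:R ^- size u * F (mon s t).
Proof.
move=> s0 t0 Fl Fr; elim: u v s t s0 t0 => [|a u IH] [|b v] s t s0 t0 //=.
  by rewrite !cats0 expr0 invr1 !mul1r.
move=> [E]; rewrite -!cat_rcons IH ?size_rcons // twisted_rcons // eqseq_cons exprS invfM.
by case: (a == b); case: (u == v); rewrite /= ?mul0r ?mulr0 //; ring.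
Qed.

(** The element representing F against w on [khom p q]: the monomials are
    orthogonal for w, and w (mon t s * mon s t) = d^-q. *)
Definition riesz (F : A -> C) p q : A :=
  d%:R ^+ q *: wsum p (fun s => wsum q (fun t => F (mon s t) *: mon t s)).

Lemma khom_riesz F p q : khom q p (riesz F p q).
Proof.
apply: mspan_scale; apply: mspan_wsum => s ss; apply: mspan_wsum => t st.
by apply: mspan_scale; apply: mspan_mon.
Qed.

Lemma w_riesz F p q s t u v : size s = p -> size t = q -> size u = size v ->
  w (riesz F p q * mon (s ++ u) (t ++ v)) =
  (u == v)%:R * d%:R ^- size u * F (mon s t).
Proof.
move=> ss st E; rewrite /riesz -scalerAl (sfZ wlin) wsum_mulr (sf_wsum wlin).
transitivity (d%:R ^+ q * wsum p (fun s' => (s' == s)%:R *: wsum q (fun t' =>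
   (t' == t)%:R *: (F (mon s' t') * ((u == v)%:R * d%:R ^- (q + size u)))))).
  congr (_ * _); apply: eq_wsum => s' ss'.
  rewrite wsum_mulr (sf_wsum wlin) wsum_scale; apply: eq_wsum => t' st'.
  rewrite -scalerAl (sfZ wlin).
  have -> : mon t' s' * mon (s ++ u) (t ++ v) = (s' == s)%:R *: mon (t' ++ u) (t ++ v).
    rewrite /mon !wd_cat mulrA -(mulrA (wd t')) (mulrA (star (wd s'))).
    rewrite wd_star ?ss ?ss' //; case: eqP => _; rewrite ?mul1r ?mulr1 ?scale1r //.
    by rewrite mul0r mulr0 mul0r scale0r.
  rewrite (sfZ wlin) wmon eqseq_cat ?st ?st' // size_cat st'.
  by rewrite /GRing.scale /=; case: (t' == t); case: (u == v); rewrite /=; ring.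
rewrite wsum_delta // wsum_delta // exprD invfM.
by rewrite mulrC -!mulrA; field; rewrite !expf_neq0.
Qed.

(** The functional given by [riesz F p q] has the same compatibility with
    lengthening words as F ([twisted_cat]), so both agree at all higher levels of
    the same degree. *)
Lemma riesz_agree F p q n x : (0 < p)%N -> (0 < q)%N -> scalar F -> twisted F ->
  khom (p + n) (q + n) x -> w (riesz F p q * x) = F x.
Proof.
move=> p0 q0 Fl Fr; move: x; apply: mspan_eq => //.
  exact: (scalar_comp wlin (linear_mull _)).
move=> s t [ss st]; rewrite -(cat_take_drop p s) -(cat_take_drop q t).
have sp : size (take p s) = p by rewrite size_takel // ss leq_addr.
have tq : size (take q t) = q by rewrite size_takel // st leq_addr.
have E : size (drop p s) = size (drop q t) by rewrite !size_drop ss st !addKn.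
by rewrite w_riesz // twisted_cat ?sp ?tq.
Qed.

Lemma w_deg a b x : khom a b x -> a <> b -> w x = 0.
Proof.
move=> hx ab; move: x hx; apply: (mspan_eq (G := fun=> 0)) => // [c x y|s t [sa tb]].
  by rewrite mulr0 addr0.
by rewrite wmon; case: eqP => [E|]; rewrite ?mul0r //; case: ab; rewrite -sa -tb E.
Qed.

Lemma w_deg_mul a b p q x y : khom q p y -> khom a b x -> (a + q)%N <> (b + p)%N ->
  w (y * x) = 0.
Proof.
move=> hy hx E.
have h1 : khom (q + a) (p + a) y by apply: khom_lift.
have h2 : khom (a + p) (b + p) x by apply: khom_lift.
rewrite (addnC p) in h1; rewrite addnC in E.
exact: w_deg (khom_mul h1 h2) E.
Qed.

(** In the degree of [khom p q] the functional coincides with F; in the other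
    degrees both sides of the relation vanish. *)
Lemma riesz_twisted F p q : (0 < p)%N -> (0 < q)%N -> scalar F -> twisted F ->
  twisted (fun a => w (riesz F p q * a)).
Proof.
move=> p0 q0 Fl Fr; have Gl : scalar (fun a => w (riesz F p q * a)).
  exact: (scalar_comp wlin (linear_mull _)).
apply: (mspan_eq (F := fun x => w (riesz F p q * (r * x * r))) (G := fun x =>
  d%:R^-1 * \sum_i w (riesz F p q * (star (S i) * x * S i)))).
- exact: (scalar_comp Gl (linear_mullr _ _)).
- move=> a y z; rewrite mulrA (mulrC a) -!mulrA -mulrDr; congr (_ * _).
  rewrite mulr_sumr -big_split; apply: eq_bigr => i _ /=.
  by rewrite linear_mullr; apply: Gl.
move=> s t _.
have hx : khom ((size s).+1 + p).+1 ((size t).+1 + p).+1 (mon s t).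
  have e n : (n.+1 + p).+1 = (n + p.+2)%N by lia.
  by rewrite !e; apply/khom_lift/khom_mon.
have hrx : khom ((size s).+1 + p).+1 ((size t).+1 + p).+1 (r * mon s t * r).
  by apply: khom_mul (khom_mul _ hx) _; apply: khom_ge2.
have [E|/eqP E] := eqVneq (size s + q)%N (size t + p)%N.
  have e1 : ((size s).+1 + p = p + (size s).+1)%N by rewrite addnC.
  have e2 : ((size t).+1 + p = q + (size s).+1)%N by rewrite addSn -E addnS addnC.
  have ag n y : khom (p + n) (q + n) y -> w (riesz F p q * y) = F y by apply: riesz_agree.
  rewrite e1 e2 -!addnS in hrx hx.
  rewrite (ag _ _ hrx) Fr; last exact: alg0_mon.
  congr (_ * _); apply: eq_bigr => i _; rewrite (ag (size s).+1) //.
  by apply: khom_SxS; rewrite -!addnS.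
rewrite (w_deg_mul (khom_riesz _ _ _) hrx); last first.
  by move=> E'; apply: E; lia.
rewrite big1 ?mulr0 // => i _; apply: (w_deg_mul (khom_riesz _ _ _) (khom_SxS i hx)).
by move=> E'; apply: E; lia.
Qed.

Lemma w_r x : alg0 x -> w (r * x) = w (x * r).
Proof. by move=> hx; rewrite (w_khom hr hx) divff ?mul1r // expf_neq0. Qed.

Lemma alg0_r : alg0 r. Proof. exact: khom_alg0 hr. Qed.

Lemma w_phi y a : alg0 y -> alg0 a ->
  w (phi y * a) = d%:R^-1 * \sum_i w (y * (star (S i) * a * S i)).
Proof.
move=> hy ha; rewrite /phi mulr_suml (sf_sum wlin) mulr_sumr; apply: eq_bigr => i _.
rewrite -!mulrA w_S; first by rewrite !mulrA.
by apply: alg0_mul => //; apply: alg0_starS.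
Qed.

Lemma w_rxr y a : alg0 y -> alg0 a -> w (r * y * r * a) = w (y * (r * a * r)).
Proof.
by move=> hy ha; rewrite -!mulrA w_r -?mulrA //; do ?[apply: alg0_mul => //; try exact: alg0_r].
Qed.

(** The two sides define the same functional against w, and w is faithful on
    [khom]. *)
Lemma twisted_comm p q y : (0 < p)%N -> (0 < q)%N -> khom q p y ->
  twisted (fun a => w (y * a)) -> r * y * r = phi y.
Proof.
move=> p0 q0 hy Hy; apply/eqP; rewrite -subr_eq0; apply/eqP.
have Ay := khom_alg0 hy.
have hz : khom q.+1 p.+1 (r * y * r - phi y).
  apply: mspan_add; last by rewrite -scaleN1r; apply/mspan_scale/khom_phi.
  apply: khom_mul (khom_mul (khom_ge2 _) (_ : khom q.+1 p.+1 y)) (khom_ge2 _) => //.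
  by rewrite -[q.+1]addn1 -[p.+1]addn1; apply: khom_lift.
apply: (khom_faithful hz) => a ha; have Aa := khom_alg0 ha.
rewrite (w_khom ha (khom_alg0 hz)) mulrBl -scaleN1r addrC wlin.
by rewrite w_rxr // Hy // -w_phi // mulN1r addNr mulr0.
Qed.

Lemma comm_twisted z : alg0 z -> r * z * r = phi z -> twisted (fun a => w (z * a)).
Proof. by move=> hz E a ha; rewrite -w_rxr // E w_phi. Qed.

(** * Twisted functionals in the irreducible case *)

Hypothesis Hirr : forall a, khom 1 1 a -> r * a * r = phi a -> exists c, a = c%:A.

Lemma twisted_deg0 F : scalar F -> twisted F ->
  exists c, forall n x, khom n n x -> F x = c * w x.
Proof.
move=> Fl Fr; have [c E] := Hirr (khom_riesz F 1 1)
  (twisted_comm (ltn0Sn 0) (ltn0Sn 0) (khom_riesz F 1 1) (riesz_twisted (ltn0Sn 0) (ltn0Sn 0) Fl Fr)).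
exists c => n x hx; have hx1 : khom (1 + n) (1 + n) x by rewrite addnC; apply: khom_lift.
by rewrite -(riesz_agree _ _ Fl Fr hx1) // E -scalerAl mul1r (sfZ wlin).
Qed.

(** A solution at any level n defines a twisted functional, which is determined
    at level one. *)
Lemma comm_scalar n z : khom n n z -> r * z * r = phi z -> exists c, z = c%:A.
Proof.
move=> hz E; have [c H] := twisted_deg0 (scalar_comp wlin (linear_mull z))
  (comm_twisted (khom_alg0 hz) E).
exists c; apply/eqP; rewrite -subr_eq0; apply/eqP.
have hz' : khom n n (z - c%:A).
  apply: mspan_add => //; rewrite -scaleN1r; do 2 apply: mspan_scale.
  by rewrite -(wsum_mon n); apply: mspan_wsum => s ss; apply: mspan_mon.
apply: (khom_faithful hz') => a ha; rewrite (w_khom ha (khom_alg0 hz')).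
have -> : (z - c%:A) * a = z * a - c *: a by rewrite mulrBl -scalerAl mul1r.
by rewrite -scaleN1r addrC wlin (sfZ wlin) mulN1r -(H _ _ ha) addNr mulr0.
Qed.

Lemma phi_comm_star y : r * y * r = phi y -> r * star y * r = phi (star y).
Proof. by move=> E; rewrite -star_phi -E !starM r_star mulrA. Qed.

Lemma phi_comm_mul y z : r * y * r = phi y -> r * z * r = phi z ->
  r * (y * z) * r = phi (y * z).
Proof.
move=> Ey Ez; rewrite phiM -Ey -Ez !mulrA -(mulrA _ r r) rr mulr1 //.
Qed.

(** If y is nonzero, the scalars y * star y and star y * y are equal, since
    (y * star y) * y = y * (star y * y); but their values under w differ by the
    factor d^(p - q). *)
Lemma comm_deg0 p q y : (0 < p)%N -> (0 < q)%N -> p <> q -> khom q p y ->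
  r * y * r = phi y -> y = 0.
Proof.
move=> p0 q0 pq hy E; have Es := phi_comm_star E.
have [c1 E1] := comm_scalar (khom_mul hy (khom_star hy)) (phi_comm_mul E Es).
have [c2 E2] := comm_scalar (khom_mul (khom_star hy) hy) (phi_comm_mul Es E).
apply/eqP; case: (eqVneq y 0) => // y0.
have c12 : c1 = c2.
  apply/eqP; rewrite -subr_eq0; have : (c1 - c2) *: y = 0.
    rewrite scalerBl -[y in c1 *: y]mul1r -[y in c2 *: y]mulr1.
    by rewrite scalerAl scalerAr -E1 -E2 mulrA subrr.
  by move/eqP; rewrite scaler_eq0 (negbTE y0) orbF.
have := w_khom hy (alg0_star (khom_alg0 hy)); rewrite E1 E2 !wA c12.
(* this is where d > 1 and p <> q enter *)
have K : d%:R ^+ p * d%:R ^- q != 1 :> C.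
  apply/eqP; move/(congr1 (fun z : C => z * d%:R ^+ q)); rewrite mulfVK ?expf_neq0 // mul1r.
  by rewrite -!natrX => /eqP; rewrite eqr_nat eqn_exp2l // => /eqP.
move=> /eqP; rewrite -{1}[c2]mul1r -subr_eq0 -mulrBl mulf_eq0 subr_eq0 eq_sym (negbTE K) /=.
move=> /eqP c20; move: y0; rewrite (_ : y = 0) ?eqxx //.
by apply: star_mul_eq0; rewrite E2 c20 scale0r.
Qed.

(** Each monomial is handled at the lowest level with both lengths positive in
    its degree. *)
Theorem twisted_scalar F : scalar F -> twisted F -> exists c, forall a, alg0 a -> F a = c * w a.
Proof.
move=> Fl Fr; have [c H] := twisted_deg0 Fl Fr; exists c.
apply: mspan_eq => // [a x y|s t _]; first by rewrite wlin; ring.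
have [E|/eqP E] := eqVneq (size s) (size t).
  by apply: H (size s) _ _; apply: mspan_mon.
(* one of the truncated differences is 0 *)
pose p := (1 + (size s - size t))%N; pose q := (1 + (size t - size s))%N.
have y0 : riesz F p q = 0.
  apply: (@comm_deg0 p q); rewrite ?addnS //; last 2 first.
  - exact: khom_riesz.
  - by apply: twisted_comm (khom_riesz _ _ _) (riesz_twisted _ _ Fl Fr).
  by rewrite /p /q; lia.
have hx : khom (p + minn (size s) (size t)) (q + minn (size s) (size t)) (mon s t).
  have [-> ->] : (p + minn (size s) (size t) = size s + 1 /\
      q + minn (size s) (size t) = size t + 1)%N by rewrite /p /q; lia.
  by apply: khom_lift; apply: khom_mon.
rewrite -(riesz_agree _ _ Fl Fr hx) // y0 mul0r (sf0 wlin) wmon.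
by case: eqP E => [->|] //; rewrite mul0r mulr0.
Qed.
End Cuntz.

(** * Bounded operators on a Hilbert space *)

Section Bounded.
Variable R : realType.
Local Notation C := R[i].
Variable H : hilbert R.

Lemma small0 (V : normedModType C) (z : V) : (forall e : C, 0 < e -> `|z| < e) -> z = 0.
Proof.
move=> h; apply/eqP; case: eqVneq => // z0; have := h `|z|.
by rewrite normr_gt0 z0 ltxx => /(_ isT).
Qed.

Lemma mul_small (c e : C) : 0 <= c -> 0 < e ->
  exists2 e', 0 < e' & forall t, 0 <= t -> t < e' -> c * t < e.
Proof.
move=> c0 e0; have c1 : 0 < c + 1 by rewrite ltr_wpDl.
exists (e / (c + 1)); first exact: divr_gt0.
move=> t t0; rewrite ltr_pdivlMr // => te; apply: le_lt_trans te.
by rewrite mulrDr mulr1 mulrC lerDl.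
Qed.

Lemma bounded_pos (T : H -> H) : bounded_op T ->
  exists2 K : C, 0 <= K & forall x, `|T x| <= K * `|x|.
Proof.
case=> _ [K hK]; exists `|K| => // x; have := hK x.
have := le_trans (normr_ge0 _) (hK x) => /ger0_norm <-.
by rewrite normrM normr_id.
Qed.

Lemma ip_cauchy (u v : H) : `|ip H u v| ^+ 2 <= `|u| ^+ 2 * `|v| ^+ 2.
Proof.
have [->|v0] := eqVneq v 0; first by rewrite linear0r !normr0 !expr0n /= mulr0.
have nv : `|v| ^+ 2 != 0 by rewrite expf_neq0 ?normr_eq0.
pose a := ip H u v / `|v| ^+ 2.
have E : ip H (u - a *: v) (u - a *: v) = `|u| ^+ 2 - `|ip H u v| ^+ 2 / `|v| ^+ 2.
  rewrite linearBl linearBr /= linearBr /= !linearZl_LR !linearZr_LR /= !ip_norm.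
  have -> : ip H v u = conjC (ip H u v) by rewrite (hermC (ip H) v u) expr0 mul1r.
  have cN : conjC (`|v| ^+ 2) = `|v| ^+ 2.
    by apply: conj_Creal; rewrite ger0_real // exprn_ge0.
  by rewrite normCK /a rmorphM fmorphV /= cN /GRing.scale /=; field; rewrite normr_eq0.
have : 0 <= ip H (u - a *: v) (u - a *: v) by rewrite ip_norm exprn_ge0.
rewrite E subr_ge0 ler_pdivrMr // lt_def nv exprn_ge0 //.
Qed.

Lemma ip_cauchy1 (u v : H) : `|ip H u v| <= `|u| * `|v|.
Proof. by rewrite -(@ler_pXn2r _ 2) ?nnegrE ?mulr_ge0 // exprMn ip_cauchy. Qed.

Definition dense_set (X : set H) : Prop :=
  forall (v : H) (e : C), 0 < e -> exists2 u, X u & `|v - u| < e.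

Lemma dense_op_eq (X : set H) (T T' : H -> H) : dense_set X ->
  bounded_op T -> bounded_op T' -> (forall u, X u -> T u = T' u) -> T = T'.
Proof.
move=> dX bT bT' E; apply/funext => v; apply/eqP; rewrite -subr_eq0; apply/eqP.
have [K K0 hK] := bounded_pos bT; have [K' K'0 hK'] := bounded_pos bT'.
apply: small0 => e e0; have [e' e'0 he] := mul_small (addr_ge0 K0 K'0) e0.
have [u Xu uv] := dX v _ e'0; apply: le_lt_trans (he _ (normr_ge0 _) uv).
have -> : T v - T' v = T (v - u) - T' (v - u).
  have lB (S : H -> H) : bounded_op S -> S (v - u) = S v - S u.
    by case=> Sl _; rewrite lfB.
  by rewrite !lB // (E u) // opprB addrA subrK.
by rewrite mulrDl (le_trans (ler_normB _ _)) // lerD.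
Qed.

Lemma dense_ip_eq (X : set H) (T T' : H -> H) (z : H) : dense_set X ->
  bounded_op T -> bounded_op T' -> (forall u, X u -> ip H (T u) z = ip H (T' u) z) ->
  forall v, ip H (T v) z = ip H (T' v) z.
Proof.
move=> dX bT bT' E v; apply/eqP; rewrite -subr_eq0; apply/eqP.
have [K K0 hK] := bounded_pos bT; have [K' K'0 hK'] := bounded_pos bT'.
apply: (@small0 C^o) => e e0.
have [e' e'0 he] := mul_small (mulr_ge0 (normr_ge0 z) (addr_ge0 K0 K'0)) e0.
have [u Xu uv] := dX v _ e'0; apply: le_lt_trans (he _ (normr_ge0 _) uv).
have -> : ip H (T v) z - ip H (T' v) z = ip H (T (v - u)) z - ip H (T' (v - u)) z.
  have lB (S : H -> H) : bounded_op S -> S (v - u) = S v - S u.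
    by case=> Sl _; rewrite lfB.
  by rewrite !lB // !linearBl /= (E u) // opprB addrA subrK.
rewrite -linearBl /= (le_trans (ip_cauchy1 _ _)) // mulrC -mulrA ler_wpM2l //.
by rewrite mulrDl (le_trans (ler_normB _ _)) // lerD.
Qed.

Lemma orth_dense0 (X : set H) (z : H) : dense_set X ->
  (forall u, X u -> ip H z u = 0) -> z = 0.
Proof.
move=> dX E; apply: small0 => e e0; have [u Xu uz] := dX z _ e0.
apply: le_lt_trans uz; rewrite -(@ler_pXn2r _ 2) ?nnegrE //.
rewrite -!ip_norm linearBl linearBr /= linearBr /= (hermC (ip H) u z) /= (E u) //.
by rewrite rmorph0 mulr0 sub0r opprK subr0 lerDl ip_norm exprn_ge0.
Qed.

(** The order of the complex numbers is only partial, so half the harmonic mean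
    serves instead of the minimum of two positive numbers. *)
Lemma min_pos (a b : C) : 0 < a -> 0 < b -> exists2 c, 0 < c & c <= a /\ c <= b.
Proof.
move=> a0 b0; have ab0 : 0 < a + b by rewrite addr_gt0.
exists (a * b / (a + b)); first by rewrite divr_gt0 ?mulr_gt0.
split; rewrite ler_pdivrMr //.
  by rewrite ler_pM2l // lerDr ltW.
by rewrite mulrC ler_pM2l // lerDl ltW.
Qed.

(** The value at v is the limit of g a as j a tends to v.  It is characterised
    by approximation to any precision, which gives uniqueness and hence
    linearity; existence is the completeness of H, applied to the filter generated by
    the images under g of the approximations of v. *)
Lemma bounded_extension (E : lmodType C) (P : E -> Prop) (j g : E -> H) (K : C) :
  linear j -> linear g -> (forall c a b, P a -> P b -> P (c *: a + b)) ->
  0 <= K -> (forall a, P a -> `|g a| <= K * `|j a|) ->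
  dense_set [set j a | a in P]%classic ->
  exists rho : H -> H, bounded_op rho /\ forall a, P a -> rho (j a) = g a.
Proof.
move=> jl gl Pl K0 hK dn.
have jB := lfB jl; have gB := lfB gl.
have PB a b : P a -> P b -> P (a - b).
  by move=> Pa Pb; rewrite -scaleN1r addrC; apply: Pl.
have dist v a b : P a -> P b -> `|g a - g b| <= K * (`|v - j a| + `|v - j b|).
  move=> Pa Pb; rewrite -gB (le_trans (hK _ (PB _ _ Pa Pb))) // ler_wpM2l // jB.
  by rewrite (le_trans (ler_distD v _ _)) // (distrC (j a)).
pose rl v y := forall e : C, 0 < e -> exists a, [/\ P a, `|v - j a| < e & `|y - g a| < e].
have rl_uniq v y y' : rl v y -> rl v y' -> y = y'.
  move=> h h'; apply/eqP; rewrite -subr_eq0; apply/eqP; apply: small0 => e e0.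
  have [e' e'0 he] := mul_small (addr_ge0 ler01 K0) e0.
  have e4 : 0 < e' / 4 by rewrite divr_gt0.
  have [a [Pa va ya]] := h _ e4; have [b [Pb vb yb]] := h' _ e4.
  pose x := `|y - g a| + `|y' - g b|; pose z := `|v - j a| + `|v - j b|.
  have x0 : 0 <= x by rewrite addr_ge0.
  have z0 : 0 <= z by rewrite addr_ge0.
  have : `|y - y'| <= (1 + K) * (x + z).
    have h1 : `|y - y'| <= x + K * z.
      apply: (le_trans (ler_distD (g a) _ _)); rewrite /x -addrA lerD2l.
      apply: (le_trans (ler_distD (g b) _ _)); rewrite [leLHS]addrC (distrC (g b)) lerD2l.
      exact: dist.
    apply: (le_trans h1); have Kx : 0 <= K * x by apply: mulr_ge0.
    have -> : (1 + K) * (x + z) = x + K * z + (K * x + z) by ring.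
    by rewrite lerDl addr_ge0.
  move/le_lt_trans; apply; apply: he; first exact: addr_ge0.
  have -> : e' = (e' / 4 + e' / 4) + (e' / 4 + e' / 4) by field.
  by rewrite !ltrD.
have rl_ex v : exists y, rl v y.
  pose B e := [set g a | a in [set a | P a /\ `|v - j a| < e]]%classic.
  pose F := filter_from [set e : C | 0 < e] B.
  have FF : ProperFilter F.
    apply: filter_from_proper; last first.
      by move=> e /= e0; have [_ [a Pa <-] va] := dn v _ e0; exists (g a); exists a.
    apply: filter_from_filter; first by exists 1 => /=.
    move=> e1 e2 /= p1 p2; have [e3 p3 [l1 l2]] := min_pos p1 p2.
    by exists e3 => // _ [a [Pa va] <-]; split; exists a => //; split=> //;
      apply: lt_le_trans va _.
  have cF : cauchy F.
    apply: cauchy_exP => e e0; have [e' e'0 he] := mul_small K0 e0.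
    have e2 : 0 < e' / 2 by rewrite divr_gt0.
    have [_ [a Pa <-] va] := dn v _ e2.
    exists (g a); exists (e' / 2) => // _ [b [Pb vb] <-]; rewrite -ball_normE /=.
    rewrite (le_lt_trans (dist v _ _ Pa Pb)) // he ?addr_ge0 //.
    by rewrite [ltRHS]splitr ltrD.
  pose l := lim F; have hl : (F --> l)%classic := @cauchy_cvg _ F FF cF.
  exists l => e e0; have [e1 /= p1 h1] := (fcvgrPdist_lt _).1 hl e e0.
  have [e3 p3 [l1 l2]] := min_pos p1 e0.
  have [_ [a Pa <-] va] := dn v _ p3; exists a; split=> //.
    exact: lt_le_trans va l2.
  by apply: h1; exists a => //; split=> //; apply: lt_le_trans va l1.
have [rho hrho] := choice rl_ex.
exists rho; split; last first.
  by move=> a Pa; apply: (rl_uniq (j a)) => // e e0; exists a; rewrite !subrr !normr0.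
have rho_lin : linear rho.
  move=> c v v'; apply: (rl_uniq (c *: v + v')) => // e e0.
  have [e' e'0 he] := mul_small (addr_ge0 (normr_ge0 c) ler01) e0.
  have e2 : 0 < e' / 2 by rewrite divr_gt0.
  have [a [Pa va ya]] := hrho v _ e2; have [b [Pb vb yb]] := hrho v' _ e2.
  have lc (x x' y y' : H) : `|x - y| < e' / 2 -> `|x' - y'| < e' / 2 ->
      `|c *: x + x' - (c *: y + y')| < e.
    move=> h h'; have hs : `|x - y| + `|x' - y'| < e' by rewrite [ltRHS]splitr ltrD.
    apply: le_lt_trans (he _ (addr_ge0 (normr_ge0 _) (normr_ge0 _)) hs).
    rewrite opprD addrACA -scalerBr (le_trans (ler_normD _ _)) // normrZ.
    rewrite mulrDl mul1r mulrDr -addrA lerD2l.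
    by rewrite [leRHS]addrA lerDr addr_ge0 // mulr_ge0.
  exists (c *: a + b); split; first exact: Pl.
    by rewrite jl; apply: lc.
  by rewrite gl; apply: lc.
split=> //; exists (K * 2 + 1) => v.
have [->|v0] := eqVneq v 0.
  by rewrite (lf0 rho_lin) !normr0 mulr0.
have nv : 0 < `|v| by rewrite normr_gt0.
have [a [Pa va ya]] := hrho v _ nv.
have -> : rho v = (rho v - g a) + g a by rewrite subrK.
rewrite (le_trans (ler_normD _ _)) // addrC mulrDl mul1r lerD //; last exact: ltW.
rewrite (le_trans (hK _ Pa)) // -mulrA ler_wpM2l //.
have -> : j a = v - (v - j a) by rewrite opprB addrC subrK.
by rewrite (le_trans (ler_normB _ _)) // mulr_natl mulr2n lerD2l ltW.
Qed.
End Bounded.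

(** * Right multiplications and the relative commutant *)

Section Gns.
Variables (R : realType) (A : cstarAlg R) (d : nat) (S : 'I_d -> A).
Local Notation C := R[i].
Hypothesis SS : forall i j, star (S i) * S j = (i == j)%:R.
Hypothesis Ssum : \sum_i S i * star (S i) = 1.
Hypothesis Sgen : generates S.
Hypothesis d_gt1 : (1 < d)%N.
Variables (H : hilbert R) (pi : A -> H -> H) (Om : H).
Hypothesis rep : star_rep pi.
Hypothesis cyc : closure [set v | exists x, v = pi x Om]%classic = setT.
Let w x := ip H (pi x Om) Om.
Hypothesis wmon : forall s t, w (mon S s t) = (s == t)%:R / d%:R ^+ size s.

Lemma pi_lin x : linear (pi x). Proof. by case: rep. Qed.
Lemma pi_bound x v : `|pi x v| <= cnorm x * `|v|. Proof. by case: rep. Qed.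
Lemma pi_linl v : linear (pi^~ v). Proof. by move=> a x y; case: rep => _ _ ->. Qed.
Lemma pi1 : pi 1 = id. Proof. by case: rep => _ _ _ []. Qed.
Lemma piM x y v : pi (x * y) v = pi x (pi y v).
Proof. by case: rep => _ _ _ [_ ->]. Qed.
Lemma pi_adj x u v : ip H (pi x u) v = ip H u (pi (star x) v).
Proof. by case: rep => _ _ _ _; apply. Qed.
Lemma pi_bounded x : bounded_op (pi x).
Proof. by split; [exact: pi_lin|exists (cnorm x) => v; exact: pi_bound]. Qed.

Lemma wlin : scalar w.
Proof. by move=> a x y; rewrite /w pi_linl linearPl. Qed.

Lemma ipw a b : ip H (pi a Om) (pi b Om) = w (star b * a).
Proof. by rewrite /w piM [in RHS]pi_adj starK. Qed.

Lemma norm_w a : `|pi a Om| ^+ 2 = w (star a * a).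
Proof. by rewrite -ipw ip_norm. Qed.

(** Membership in the closure of the orbit of Om under [alg0]. *)
Let approx v := forall e : C, 0 < e -> exists2 a, alg0 S a & `|v - pi a Om| < e.

Let approx_lin c u v : approx u -> approx v -> approx (c *: u + v).
Proof.
move=> hu hv e e0.
have [e' e'0 he] := mul_small (addr_ge0 (normr_ge0 c) ler01) e0.
have e2 : 0 < e' / 2 by rewrite divr_gt0.
have [a Aa ua] := hu _ e2; have [b Ab vb] := hv _ e2.
exists (c *: a + b); first by apply: mspan_add => //; apply: mspan_scale.
have hs : `|u - pi a Om| + `|v - pi b Om| < e' by rewrite [ltRHS]splitr ltrD.
apply: le_lt_trans (he _ (addr_ge0 (normr_ge0 _) (normr_ge0 _)) hs).
rewrite pi_linl opprD addrACA -scalerBr (le_trans (ler_normD _ _)) // normrZ.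
rewrite mulrDl mul1r mulrDr -addrA lerD2l.
by rewrite [leRHS]addrA lerDr addr_ge0 // mulr_ge0.
Qed.

Let approx_pi b v : alg0 S b -> approx v -> approx (pi b v).
Proof.
move=> Ab hv e e0; have [e' e'0 he] := mul_small (cnorm_ge0 b) e0.
have [a Aa va] := hv _ e'0; exists (b * a); first exact: (alg0_mul SS).
have -> : pi b v - pi (b * a) Om = pi b (v - pi a Om).
  by rewrite piM (lfB (pi_lin b)).
exact: le_lt_trans (pi_bound _ _) (he _ (normr_ge0 _) va).
Qed.

Let approx_closed v : (forall e : C, 0 < e -> exists2 u, approx u & `|v - u| < e) -> approx v.
Proof.
move=> hv e e0; have e2 : 0 < e / 2 by rewrite divr_gt0.
have [u hu vu] := hv _ e2; have [a Aa ua] := hu _ e2; exists a => //.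
by rewrite (le_lt_trans (ler_distD u _ _)) // [ltRHS]splitr ltrD.
Qed.

(** The elements x such that pi x and pi (star x) preserve the closure of the
    orbit of Om under [alg0] form a norm-closed star-subalgebra containing S, which
    is everything. *)
Lemma dense_alg0 : dense_set [set pi a Om | a in alg0 S]%classic.
Proof.
have K1 : approx Om.
  by move=> e e0; exists 1; [exact: alg0_1|rewrite pi1 subrr normr0].
(* both conditions are needed for stability under star *)
pose X := [set x | (forall v, approx v -> approx (pi x v)) /\
                   (forall v, approx v -> approx (pi (star x) v))]%classic.
have XT : X = setT.
  apply: Sgen => [i|a x y [x1 x2] [y1 y2]|x y [x1 x2] [y1 y2]|x [x1 x2]|x hx].
  - split=> v; apply: approx_pi; first exact: alg0_genS.
    by apply: alg0_star; exact: alg0_genS.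
  - split=> v hv; rewrite ?starZD pi_linl; apply: approx_lin; auto.
  - by split=> v hv; rewrite ?starM piM; auto.
  - by split; rewrite ?starK.
  have key x' : (forall e : C, 0 < e -> exists2 y, (forall v, approx v -> approx (pi y v)) &
      cnorm (x' - y) < e) -> forall v, approx v -> approx (pi x' v).
    move=> h v hv; apply: approx_closed => e e0.
    have [e' e'0 he] := mul_small (normr_ge0 v) e0.
    have [y hy xy] := h _ e'0; exists (pi y v); first exact: hy.
    have -> : pi x' v - pi y v = pi (x' - y) v.
      by rewrite (lfB (pi_linl v)).
    by apply: le_lt_trans (he _ (cnorm_ge0 _) xy); rewrite mulrC pi_bound.
  split; apply: key => e e0; have [y [y1 y2] xy] := hx e e0.
    by exists y.
  by exists (star y) => //; rewrite -starB cnorm_starE.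
move=> v e e0; have e2 : 0 < e / 2 by rewrite divr_gt0.
have : closure [set v | exists x, v = pi x Om]%classic v by rewrite cyc.
move=> /(_ (ball v (e / 2)) (nbhsx_ballx _ _ e2)) [_ [[x ->]]].
rewrite -ball_normE /= => vx.
have [hx _] : X x by rewrite XT.
have [a Aa xa] := hx _ K1 _ e2; exists (pi a Om); first by exists a.
by rewrite (le_lt_trans (ler_distD (pi x Om) _ _)) // [ltRHS]splitr ltrD.
Qed.

Let rbound b := exists2 K : C, 0 <= K &
  forall a, alg0 S a -> `|pi (a * b) Om| <= K * `|pi a Om|.

Let sqr_bound (K x y : C) : 1 <= K -> 0 <= x -> 0 <= y ->
  x ^+ 2 <= K * y ^+ 2 -> x <= K * y.
Proof.
move=> K1 x0 y0 h; have K0 : 0 <= K := le_trans ler01 K1.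
rewrite -(@ler_pXn2r _ 2) ?nnegrE ?mulr_ge0 // (le_trans h) // exprMn.
by rewrite ler_wpM2r ?exprn_ge0 // ler_eXnr.
Qed.

Let dC : (d%:R : C) != 0.
Proof. by rewrite pnatr_eq0 -lt0n ltnW. Qed.

(** The squares of the norms of the vectors a (S j) Om sum up to d times the
    square of the norm of a Om, by the modular property and
    \sum_j S j * star (S j) = 1. *)
Let rbound_S i : rbound (S i).
Proof.
exists d%:R => // a Aa; apply: sqr_bound => //; first by rewrite ler1n ltnW.
have E j : `|pi (a * S j) Om| ^+ 2 = d%:R * w (star a * a * (S j * star (S j))).
  rewrite norm_w starM -!mulrA (w_starS SS wlin wmon d_gt1); first by rewrite !mulrA.
  by apply: (alg0_mul SS); [exact: alg0_star|apply: (alg0_xS SS)].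
have : \sum_j `|pi (a * S j) Om| ^+ 2 = d%:R * `|pi a Om| ^+ 2.
  rewrite (eq_bigr _ (fun j _ => E j)) -mulr_sumr -(sf_sum wlin) -mulr_sumr Ssum.
  by rewrite mulr1 norm_w.
by rewrite (bigD1 i) //= => <-; rewrite lerDl sumr_ge0 // => j _; rewrite exprn_ge0.
Qed.

Let rbound_starS i : rbound (star (S i)).
Proof.
exists 1 => // a Aa; apply: sqr_bound => //; rewrite !norm_w starM starK -!mulrA.
rewrite (w_S SS wlin wmon); last first.
  by apply: (alg0_mul SS); [exact: alg0_star|apply: alg0_xstarS].
rewrite -!mulrA SS eqxx mulr1 -norm_w mul1r.
have d0 : (0 < d)%N := ltnW d_gt1.
by rewrite ler_piMl ?exprn_ge0 // invf_le1 ?ltr0n // ler1n.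
Qed.

Let rbound_mul b c : alg0 S b -> rbound b -> rbound c -> rbound (b * c).
Proof.
move=> Ab [Kb Kb0 hb] [Kc Kc0 hc]; exists (Kc * Kb); first exact: mulr_ge0.
move=> a Aa; rewrite mulrA (le_trans (hc _ _)) //; first exact: (alg0_mul SS).
by rewrite -mulrA ler_wpM2l // hb.
Qed.

Lemma right_mul_bounded b : alg0 S b -> rbound b.
Proof.
have r1 : rbound 1 by exists 1 => // a _; rewrite mulr1 mul1r.
have rm s t : rbound (mon S s t).
  apply: rbound_mul.
  - by have := alg0_mon S s [::]; rewrite /mon wd0 star1 mulr1.
  - elim: s => [|i s IH]; first by rewrite wd0.
    by rewrite wd_cons; apply: rbound_mul; [exact: alg0_genS|exact: rbound_S|exact: IH].
  elim: t => [|i t IH]; first by rewrite wd0 star1.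
  rewrite wd_cons starM; apply: rbound_mul; [|exact: IH|exact: rbound_starS].
  by have := alg0_mon S [::] t; rewrite /mon wd0 mul1r.
elim=> [|c s t x _ Ax [K K0 hK]].
  exists 0 => // a _; rewrite mulr0 mul0r.
  by rewrite (lf0 (pi_linl Om)) normr0.
have [K' K'0 hK'] := rm s t; exists (`|c| * K' + K); first by rewrite addr_ge0 ?mulr_ge0.
move=> a Aa; rewrite mulrDr -scalerAr pi_linl (le_trans (ler_normD _ _)) // normrZ mulrDl.
by rewrite lerD ?hK // -mulrA ler_wpM2l // hK'.
Qed.

(** Right multiplication is bounded because w is modular, and it commutes with
    the left action, first on the orbit of Om and then everywhere by density. *)
Lemma right_mul b : alg0 S b -> exists rho : H -> H,
  [/\ bounded_op rho, forall x, rho \o pi x = pi x \o rho &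
      forall a, alg0 S a -> rho (pi a Om) = pi (a * b) Om].
Proof.
move=> Ab; have [K K0 hK] := right_mul_bounded Ab.
have [rho [brho hrho]] : exists rho : H -> H, bounded_op rho /\
    forall a, alg0 S a -> rho (pi a Om) = pi (a * b) Om.
  apply: (@bounded_extension _ H A (alg0 S) (pi^~ Om) (fun a => pi (a * b) Om) K) => //.
  - exact: pi_linl.
  - by move=> a x y; rewrite mulrDl -scalerAl pi_linl.
  - by move=> c a x Aa Ax; apply: mspan_add => //; apply: mspan_scale.
  - exact: dense_alg0.
exists rho; split=> //.
have bcomp T T' : bounded_op T -> bounded_op T' -> bounded_op (T \o T' : H -> H).
  move=> bT bT'; have [Q Q0 hQ] := bounded_pos bT; have [Q' Q'0 hQ'] := bounded_pos bT'.
  split; first by move=> c u v /=; case: bT bT' => Tl _ [Tl' _]; rewrite Tl' Tl.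
  by exists (Q * Q') => v /=; rewrite (le_trans (hQ _)) // -mulrA ler_wpM2l.
have comm0 x : alg0 S x -> rho \o pi x = pi x \o rho.
  move=> Ax; apply: (dense_op_eq dense_alg0); try by apply: bcomp => //; exact: pi_bounded.
  move=> _ [a Aa <-] /=; rewrite -piM hrho ?hrho ?piM -?mulrA ?piM //.
  exact: (alg0_mul SS).
pose X := [set x | rho \o pi x = pi x \o rho /\ rho \o pi (star x) = pi (star x) \o rho]%classic.
have XT : X = setT; last by move=> x; have [] : X x by rewrite XT.
have rl : linear rho by case: brho.
apply: Sgen => [i|a x y [x1 x2] [y1 y2]|x y [x1 x2] [y1 y2]|x [x1 x2]|x hx].
- by split; apply: comm0; [|apply: alg0_star]; exact: alg0_genS.
- have key z z' c : rho \o pi z = pi z \o rho -> rho \o pi z' = pi z' \o rho ->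
      rho \o pi (c *: z + z') = pi (c *: z + z') \o rho.
    move=> h h'; apply/funext => v /=; rewrite !pi_linl rl.
    by have /= -> := congr1 (@^~ v) h; have /= -> := congr1 (@^~ v) h'.
  by split; rewrite ?starZD; apply: key.
- have key z z' : rho \o pi z = pi z \o rho -> rho \o pi z' = pi z' \o rho ->
      rho \o pi (z * z') = pi (z * z') \o rho.
    move=> h h'; apply/funext => v /=; rewrite !piM.
    by have /= -> := congr1 (@^~ (pi z' v)) h; have /= -> := congr1 (@^~ v) h'.
  by split; rewrite ?starM; apply: key.
- by split; rewrite ?starK.
have [Q Q0 hQ] := bounded_pos brho.
have key x' : (forall e : C, 0 < e -> exists2 y, rho \o pi y = pi y \o rho &
      cnorm (x' - y) < e) -> rho \o pi x' = pi x' \o rho.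
  move=> h; apply/funext => v /=; apply/eqP; rewrite -subr_eq0; apply/eqP.
  apply: small0 => e e0.
  have [e' e'0 he] := mul_small (mulr_ge0 (ler0n _ 2) (mulr_ge0 Q0 (normr_ge0 v))) e0.
  have [y hy xy] := h _ e'0; apply: le_lt_trans (he _ (cnorm_ge0 _) xy).
  have -> : rho (pi x' v) - pi x' (rho v) = rho (pi (x' - y) v) - pi (x' - y) (rho v).
    rewrite !(lfB (pi_linl _)) (lfB rl); have /= -> := congr1 (@^~ v) hy.
    by rewrite opprB addrA subrK.
  rewrite (le_trans (ler_normB _ _)) //.
  have -> : 2%:R * (Q * `|v|) * cnorm (x' - y) =
     Q * (cnorm (x' - y) * `|v|) + cnorm (x' - y) * (Q * `|v|) by ring.
  rewrite lerD //; first by rewrite (le_trans (hQ _)) // ler_wpM2l // pi_bound.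
  by rewrite (le_trans (pi_bound _ _)) // ler_wpM2l // cnorm_ge0.
split; apply: key => e e0; have [y [y1 y2] xy] := hx e e0; first by exists y.
by exists (star y) => //; rewrite -starB cnorm_starE.
Qed.

Variable r : A.
Hypothesis hr : khom S 2 2 r.
Hypothesis r_star : star r = r.
Hypothesis rr : r * r = 1.
Hypothesis Hirr : forall a, khom S 1 1 a -> r * a * r = phi S a -> exists c, a = c%:A.

Variable X : H -> H.
Hypothesis bX : bounded_op X.
Hypothesis Xbicomm : forall Y, bounded_op Y -> (forall x, Y \o pi x = pi x \o Y) -> X \o Y = Y \o X.
Hypothesis XrS : forall i, X \o pi (r * S i) = pi (r * S i) \o X.

(** If w exchanges b for s under cyclic permutation, so does the vector state of
    Om for the operator of right multiplication by b. *)
Lemma rho_trace b s rho : bounded_op rho -> (forall a, alg0 S a -> rho (pi a Om) = pi (a * b) Om) ->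
  (forall a, alg0 S a -> w (a * b) = w (s * a)) ->
  forall v, ip H (rho v) Om = ip H (pi s v) Om.
Proof.
move=> brho hrho hs; apply: (dense_ip_eq dense_alg0) => //; first exact: pi_bounded.
by move=> _ [a Aa <-]; rewrite hrho // -piM; apply: hs.
Qed.

(** Summing X (r S_i) = (r S_i) X against star (S_i) gives
    r X r = \sum_i S_i X star (S_i).  Applied to Om, the rightmost factors r and
    star (S_i) become right multiplications, which commute with X and with the left
    action, and return to the left side through the state: r as r, and
    star (S_i) as d^-1 star (S_i). *)
Lemma commutant_twisted : twisted S r (fun a => ip H (pi a (X Om)) Om).
Proof.
move=> a Aa; have Xl : linear X by case: bX.
have cE Y Z v : Y \o Z = Z \o Y :> (H -> H) -> Y (Z v) = Z (Y v).
  by move=> /(congr1 (@^~ v)).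
have [rho [b1 b2 b3]] := right_mul (khom_alg0 hr).
have tr v : ip H (rho v) Om = ip H (pi r v) Om.
  by apply: (rho_trace b1 b3) => b Ab; rewrite (w_r SS wlin wmon d_gt1 hr).
have key v : pi r (X (pi r v)) = \sum_i pi (S i) (X (pi (star (S i)) v)).
  have -> : pi r v = \sum_i pi (r * S i) (pi (star (S i)) v).
    rewrite -[r in LHS]mulr1 -Ssum mulr_sumr (lf_sum (pi_linl v)).
    by apply: eq_bigr => i _; rewrite mulrA piM.
  rewrite (lf_sum Xl) (lf_sum (pi_lin r)); apply: eq_bigr => i _.
  by rewrite (cE _ _ _ (XrS i)) -piM mulrA rr mul1r.
have rhoX s T : bounded_op T -> (forall x, T \o pi x = pi x \o T) ->
    (forall a, alg0 S a -> T (pi a Om) = pi (a * s) Om) -> X (pi s Om) = T (X Om).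
  move=> bT cT hT; rewrite -(cE _ _ _ (Xbicomm bT cT)).
  by have := hT 1 (alg0_1 S); rewrite mul1r pi1 => ->.
rewrite -mulrA piM -tr (cE _ _ _ (b2 _)) -(rhoX r) // piM key.
rewrite (lf_sum (pi_lin a)) linear_sumlz mulr_sumr; apply: eq_bigr => i _.
have [rho' [c1 c2 c3]] := right_mul (alg0_star (alg0_genS S i)).
have tr' v : ip H (rho' v) Om = ip H (pi (d%:R^-1 *: star (S i)) v) Om.
  apply: (rho_trace c1 c3) => b Ab; rewrite -scalerAl (sfZ wlin).
  by rewrite (w_starS SS wlin wmon d_gt1) // mulKf.
rewrite (rhoX _ _ c1 c2 c3) -piM.
have -> : pi (a * S i) (rho' (X Om)) = rho' (pi (a * S i) (X Om)).
  by have := cE _ _ (X Om) (c2 (a * S i)) => ->.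
etransitivity; first exact: tr'.
rewrite (lfZ (pi_linl _)) linearZl_LR /=.
by rewrite -piM mulrA.
Qed.

(** The functional of X is a multiple of w, so X Om is a multiple of Om; as Om
    is cyclic for the right multiplications, X is a scalar. *)
Theorem commutant_scalar : scalar_ops X.
Proof.
have Fl : scalar (fun a => ip H (pi a (X Om)) Om).
  by move=> a x y; rewrite pi_linl linearPl.
have [c hc] := twisted_scalar SS Ssum wlin wmon d_gt1 hr r_star rr Hirr Fl commutant_twisted.
have [Xl _] := bX.
have XOm : X Om = c *: Om.
  apply/eqP; rewrite -subr_eq0; apply/eqP; apply: (orth_dense0 dense_alg0).
  move=> _ [a Aa <-]; rewrite -[a]starK -pi_adj (lfB (pi_lin _)) linearBl /=.
  rewrite hc; last exact: alg0_star.
  by rewrite (lfZ (pi_lin _)) linearZl_LR /= /w subrr.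
exists c; apply: (dense_op_eq dense_alg0) => //.
  split; first by move=> a u v; rewrite scalerDr !scalerA mulrC.
  by exists `|c| => v; rewrite normrZ.
move=> _ [a Aa <-]; have [rho [b1 b2 b3]] := right_mul Aa; have [rl _] := b1.
have E : pi a Om = rho Om.
  by have := b3 1 (alg0_1 S); rewrite mul1r pi1.
have /= := congr1 (@^~ Om) (Xbicomm b1 b2).
by rewrite E => ->; rewrite XOm (lfZ rl).
Qed.
End Gns.

(** * The canonical state on monomials *)

Section State.
Variable R : realType.
Local Notation C := R[i].

Lemma expiD (a b : R) : expi (a + b) = expi a * expi b.
Proof.
rewrite /expi cosD sinD; apply/eqP; rewrite eq_complex /=; apply/andP; split; apply/eqP; ring.
Qed.

Lemma expi0 : expi (0 : R) = 1.
Proof. by rewrite /expi cos0 sin0. Qed.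

Lemma expi_2pi : expi (2 * pi : R) = 1.
Proof. by rewrite /expi mulr_natl cos2pi sin2pi. Qed.

Lemma expi_conj (a : R) : expi a * conjC (expi a) = 1.
Proof.
rewrite -normCK /expi normc_def /= cos2Dsin2 sqrtr1 expr1n //.
Qed.

Lemma expi_neq1 (a : R) : 0 < a -> a < 2 * pi -> expi a != 1.
Proof.
move=> a0 a2; apply/eqP => /eqP; rewrite eq_complex /= => /andP[/eqP ca _].
have h : 0 < sin (a / 2) by apply: sin_gt0_pi; rewrite divr_gt0 //= ltr_pdivrMr // mulrC.
have : cos (a / 2 + a / 2) = 1 by rewrite -splitr.
rewrite cosD => E; have := cos2Dsin2 (a / 2); nra.
Qed.

Lemma expiX (a : R) n : expi (a * n%:R) = expi a ^+ n.
Proof.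
elim: n => [|n IH]; first by rewrite mulr0 expi0 expr0.
by rewrite -natr1 mulrDr mulr1 expiD IH exprSr.
Qed.

(** A geometric sum whose ratio is an n-th root of unity other than 1; the bounds
    on a and b ensure that n does not divide a - b. *)
Lemma root_sum0 n a b : (a < n)%N -> (b < n)%N -> a <> b ->
  let z := expi (2 * pi / n%:R : R) in
  \sum_(i < n) (z ^+ a * conjC z ^+ b) ^+ i = 0.
Proof.
move=> an bn ab z; have n0 : (0 < n)%N by apply: leq_ltn_trans an.
have nz : (n%:R : R) != 0 by rewrite pnatr_eq0 -lt0n.
have zz : z * conjC z = 1 by exact: expi_conj.
have zn : z ^+ n = 1 by rewrite -expiX divfK // expi_2pi.
have z1 k : (0 < k < n)%N -> z ^+ k != 1.
  move=> /andP[k0 kn]; rewrite -expiX; have p0 := @pi_gt0 R.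
  have kR : 0 < k%:R :> R by rewrite ltr0n.
  have nR : 0 < n%:R :> R by rewrite ltr0n.
  apply: expi_neq1; first by rewrite mulr_gt0 // divr_gt0 // mulr_gt0.
  by rewrite mulrAC ltr_pdivrMr // ltr_pM2l ?mulr_gt0 // ltr_nat.
have zk k l : (k < l < n)%N -> z ^+ k = z ^+ l -> False.
  move=> /andP[kl ln] E; have := z1 (l - k)%N; rewrite subn_gt0 kl.
  rewrite (leq_ltn_trans (leq_subr _ _) ln) => /(_ isT) /eqP; apply.
  have := congr1 (fun x => x * conjC z ^+ k) E; rewrite -exprMn zz expr1n.
  by rewrite -[in RHS](subnK (ltnW kl)) exprD -mulrA -exprMn zz expr1n mulr1.
set y := _ * _; have y1 : y != 1.
  apply/eqP => E; have E' : z ^+ a = z ^+ b.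
    have := congr1 (fun x => x * z ^+ b) E.
    by rewrite /y -mulrA -exprMn (mulrC _ z) zz expr1n mulr1 mul1r.
  have [h|h|//] := ltngtP a b; first by apply: (zk a b) => //; rewrite h.
  by apply: (zk b a) => //; rewrite h.
have yn : y ^+ n = 1.
  rewrite /y exprMn -!exprM mulnC exprM zn expr1n mul1r mulnC exprM -rmorphXn zn.
  by rewrite rmorph1 expr1n.
apply/eqP; have := subrX1 y n; rewrite yn subrr => /esym/eqP.
by rewrite mulf_eq0 subr_eq0 (negbTE y1).
Qed.

Lemma small_cnorm0 (A : cstarAlg R) (x : A) : (forall e : C, 0 < e -> cnorm x < e) -> x = 0.
Proof.
move=> h; apply: cnorm0_eq0; have := cnorm_ge0 x; rewrite le_eqVlt => /predU1P[//|x0].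
by have := h _ x0; rewrite ltxx.
Qed.

(** The integral is tested on the uniform subdivisions alone, so that the gauge
    average of a monomial is an exact finite sum, without integration. *)
Lemma riemann_uniform (A : cstarAlg R) (g : R -> A) (T : R) (I J : A) N : 0 < T ->
  riemann_integral g 0 T I ->
  (forall n, (N < n)%N -> \sum_(i < n) g (T / n%:R * i%:R) = n%:R *: J) ->
  I = T%:C%C *: J.
Proof.
move=> T0 hI hJ; apply/esym/eqP; rewrite -subr_eq0; apply/eqP/small_cnorm0 => e e0.
have [delta d0 h] := hI e e0.
(* n exceeds both N and T / delta, so that the mesh T / n is below delta *)
have [M hM] : exists M : nat, T / delta < M%:R.
  exists (Num.trunc (T / delta)).+1; rewrite truncnS_gt //.
pose n := (maxn M N).+1; have n0 : 0 < n%:R :> R by rewrite ltr0n.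
pose t i : R := T / n%:R * i%:R.
have tS i : t i.+1 - t i = T / n%:R by rewrite /t -natr1 mulrDr mulr1 addrC addKr.
have := h n t t; rewrite {1}/t mulr0 {1}/t divfK ?gt_eqF // => /(_ erefl erefl).
have -> : \sum_(i < n) (t i.+1 - t i)%:C%C *: g (t i) = T%:C%C *: J.
  under eq_bigr => i _ do rewrite tS.
  rewrite -scaler_sumr hJ; last by rewrite ltnS leq_maxr.
  rewrite scalerA; congr (_ *: _).
  have -> : n%:R = (n%:R : R)%:C%C :> C by rewrite rmorph_nat.
  by rewrite -rmorphM divfK // gt_eqF.
apply=> i _; split=> //.
  by rewrite -subr_ge0 tS divr_ge0 // ltW.
rewrite tS ltr_pdivrMr // mulrC -ltr_pdivrMr //; apply: (lt_le_trans hM).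
by rewrite ler_nat /n; apply: leqW; exact: leq_maxl.
Qed.

Section Gauge.
Variables (A : cstarAlg R) (d : nat) (S : 'I_d -> A).
Hypothesis SS : forall i j, star (S i) * S j = (i == j)%:R.
Hypothesis Ssum : \sum_i S i * star (S i) = 1.

Lemma gauge_wd t gam s : cuntz_endo S (expi t)%:A gam ->
  gam (wd S s) = expi t ^+ size s *: wd S s.
Proof.
case=> -[gl g1 gM gs] gS; elim: s => [|i s IH]; first by rewrite wd0 g1 expr0 scale1r.
by rewrite wd_cons gM gS IH -scalerAl mul1r -scalerAl -scalerAr scalerA exprS.
Qed.

Lemma gauge_mon t gam s u : cuntz_endo S (expi t)%:A gam ->
  gam (mon S s u) = (expi t ^+ size s * conjC (expi t) ^+ size u) *: mon S s u.
Proof.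
move=> h; have [[gl g1 gM gs] gS] := h.
by rewrite /mon gM gs !(gauge_wd _ h) starZ rmorphXn /= -scalerAl -scalerAr scalerA.
Qed.

(** The Riemann sum over n points is a sum of powers of a root of unity: it is n
    in degree 0 and vanishes in any other degree once n is large. *)
Lemma expectation_mon E s u : gauge_expectation S E ->
  E (mon S s u) = (size s == size u)%:R *: mon S s u.
Proof.
move=> [gam hg hE]; have p2 : 0 < 2 * @pi R by rewrite mulr_gt0 // pi_gt0.
have := riemann_uniform (N := maxn (size s) (size u)) p2 (hE (mon S s u)) (J :=
  (size s == size u)%:R *: mon S s u) _.
have p0 : ((2 * pi)%:C%C : C) != 0 by rewrite eq_complex /= negb_and gt_eqF.
move=> /(_ _)/(scalerI p0); apply=> n; rewrite gtn_max => /andP[sn un].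
under eq_bigr => i _ do rewrite (gauge_mon _ _ (hg _)) expiX rmorphXn /= -!exprM
  ![(i * _)%N]mulnC !exprM -exprMn.
rewrite -scaler_suml scalerA; congr (_ *: _).
have [->|/eqP E0] := eqVneq; last by rewrite mulr0 root_sum0.
rewrite -exprMn expi_conj expr1n mulr1 (eq_bigr (fun=> 1)) => [|i _]; last by rewrite expr1n.
by rewrite sumr_const card_ord.
Qed.

Lemma khom_core n x : khom S n n x -> Fcore S x.
Proof.
move=> hx; have Fx : Fcore_n S n x.
  elim: hx => [|a s t y [ss st] _ [c ->]].
    exists (fun _ _ => 0); rewrite big1 // => mu _; rewrite big1 // => nu _.
    by rewrite scale0r.
  move/eqP: ss => ss; move/eqP: st => st.
  exists (fun mu nu => a *+ ((mu == Tuple ss) && (nu == Tuple st)) + c mu nu).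
  have -> : a *: mon S s t = \sum_mu \sum_nu
      (a *+ ((mu == Tuple ss) && (nu == Tuple st))) *: (word S mu * star (word S nu)).
    rewrite (bigD1 (Tuple ss)) //= [X in _ + X]big1 ?addr0 => [|mu /negbTE h]; last first.
      by rewrite big1 // => nu _; rewrite h mulr0n scale0r.
    rewrite (bigD1 (Tuple st)) //= [X in _ + X]big1 ?addr0 => [|nu /negbTE h]; last first.
      by rewrite h andbF mulr0n scale0r.
    by rewrite !eqxx.
  rewrite -big_split; apply: eq_bigr => mu _ /=; rewrite -big_split.
  by apply: eq_bigr => nu _ /=; rewrite scalerDl.
by move=> e e0; exists x; [exists n|rewrite subrr cnorm0].
Qed.

Variable tr : A -> C.
Hypothesis trP : normalized_trace S tr.

Lemma trace_wsum n m (g : seq 'I_d -> A) : (forall s, khom S n n (g s)) ->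
  tr (wsum m g) = wsum m (fun s => tr (g s)).
Proof.
have [trl _ _ _] := trP; have tr0 : tr 0 = 0.
  have F0 := khom_core (mspan0 S _ : khom S 0 0 0); apply: (addrI (tr 0)).
  by have := trl 1 0 0 F0 F0; rewrite scale1r mul1r !addr0.
elim: m g => [|m IH] g hg //=.
transitivity (\sum_i tr (wsum m (fun s => g (i :: s)))); last first.
  by apply: eq_bigr => i _; rewrite IH.
suff [] : khom S n n (\sum_i wsum m (fun s => g (i :: s))) /\
  tr (\sum_i wsum m (fun s => g (i :: s))) = \sum_i tr (wsum m (fun s => g (i :: s))) by [].
elim/big_rec2: _ => [|i y z _ [hz E]]; first by split; [exact: mspan0|].
have hi : khom S n n (wsum m (fun s => g (i :: s))) by apply: mspan_wsum => s _; apply: hg.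
split; first exact: mspan_add.
by have := trl 1 _ _ (khom_core hi) (khom_core hz); rewrite scale1r mul1r E.
Qed.

Lemma wsum_const m (c : C) : wsum m (fun _ : seq 'I_d => c) = d%:R ^+ m * c.
Proof.
elim: m => [|m IH] /=; first by rewrite expr0 mul1r.
by rewrite (eq_bigr _ (fun i _ => IH)) sumr_const card_ord -[LHS]mulr_natl mulrA exprS.
Qed.

(** A trace annihilates the off-diagonal matrix units and takes the same value
    on all the diagonal ones. *)
Lemma trace_mon s t : (0 < d)%N -> size s = size t ->
  tr (mon S s t) = (s == t)%:R * d%:R ^- size s.
Proof.
move=> d0; have [trl _ tr1 trM] := trP.
have cr u v : size u = size v -> Fcore S (mon S u v).
  by move=> E; apply: (@khom_core (size u)); apply: mspan_mon.
have tr0 : tr 0 = 0.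
  have F0 := khom_core (mspan0 S _ : khom S 0 0 0); apply: (addrI (tr 0)).
  by have := trl 1 0 0 F0 F0; rewrite scale1r mul1r !addr0.
have [<- _|st E] := eqVneq s t; last first.
  have -> : mon S s t = mon S s s * mon S s t by rewrite (mon_mul SS) // eqxx scale1r.
  rewrite trM; [|exact: cr|exact: cr].
  by rewrite (mon_mul SS) // eq_sym (negbTE st) scale0r tr0 mul0r.
have eqt u : size u = size s -> tr (mon S u u) = tr (mon S s s).
  move=> E; have -> : mon S u u = mon S u s * mon S s u by rewrite (mon_mul SS) // eqxx scale1r.
  rewrite trM; [|exact: cr|exact: cr].
  by rewrite (mon_mul SS) // eqxx scale1r.
have := tr1; rewrite -(wsum_mon Ssum (size s)).
have dn : (d%:R : C) ^+ size s != 0 by rewrite expf_neq0 // pnatr_eq0 -lt0n.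
rewrite (_ : wsum _ _ = wsum (size s) (fun u => if size u == size s then mon S u u else 0)).
  rewrite (trace_wsum (n := size s)) => [|u].
    rewrite (eq_wsum (G' := fun=> tr (mon S s s))) => [|u su]; last first.
      by rewrite su eqxx eqt.
    by rewrite wsum_const => E; apply: (mulfI dn); rewrite E mul1r divff.
  by case: eqP => [E|_]; [apply: mspan_mon|exact: mspan0].
by apply: eq_wsum => u ->; rewrite eqxx.
Qed.

Lemma gauge_state_mon E s t : (0 < d)%N -> gauge_expectation S E ->
  tr (E (mon S s t)) = (s == t)%:R * d%:R ^- size s.
Proof.
move=> d0 hE; rewrite (expectation_mon _ _ hE).
have [st|/eqP st] := eqVneq (size s); first by rewrite scale1r trace_mon.
have -> : (s == t) = false by apply/eqP => st'; rewrite st' in st.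
have [trl _ tr1 trM] := trP.
have F0 := khom_core (mspan0 S _ : khom S 0 0 0).
rewrite scale0r mul0r; apply: (addrI (tr 0)).
by have := trl 1 0 0 F0 F0; rewrite scale1r mul1r !addr0.
Qed.
End Gauge.
End State.

(** * Linear maps and forms on tensor products *)

Section TensorExt.
Variable F : fieldType.

Lemma tensor_sum (U W : vectType F) (A : tensor U W) :
  A = \sum_i \sum_j A i j *: ox (rbase i) (rbase j).
Proof.
apply/matrixP => k l; rewrite summxE (bigD1 k) //= [X in _ + X]big1 ?addr0 => [|i ik].
  rewrite summxE (bigD1 l) //= [X in _ + X]big1 ?addr0 => [|j jl].
    by rewrite !mxE /rbase !coord_free ?(basis_free (vbasisP _)) // !eqxx !mulr1.
  by rewrite !mxE /rbase !coord_free ?(basis_free (vbasisP _)) // (negbTE jl) !mulr0.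
rewrite summxE big1 // => j _.
by rewrite !mxE /rbase !coord_free ?(basis_free (vbasisP _)) // (negbTE ik) mul0r mulr0.
Qed.

Lemma tensor_ext (U W : vectType F) (Z : lmodType F) (g h : tensor U W -> Z) :
  linear g -> linear h -> (forall u w, g (ox u w) = h (ox u w)) -> g =1 h.
Proof.
move=> gl hl E A; rewrite (tensor_sum A) (lf_sum gl) (lf_sum hl).
apply: eq_bigr => i _; rewrite (lf_sum gl) (lf_sum hl); apply: eq_bigr => j _.
by rewrite (lfZ gl) (lfZ hl) E.
Qed.

Lemma tmap_linear (U U' W W' : vectType F) (g : U -> U') (h : W -> W') :
  linear (tmap g h).
Proof. exact: tlift_linear. Qed.

Lemma lfun_linear (U W : vectType F) (g : 'Hom(U, W)) : linear g.
Proof. by move=> a x y; rewrite linearP. Qed.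

Lemma linear_cmp (U W Z : lmodType F) (g : W -> Z) (h : U -> W) :
  linear g -> linear h -> linear (g \o h).
Proof. by move=> gl hl a x y /=; rewrite hl gl. Qed.

Lemma id_linear (U : lmodType F) : linear (@id U). Proof. by []. Qed.
End TensorExt.

Section TensorDot.
Variable R : realType.
Local Notation C := R[i].

Lemma tdot_linear (U W : vectType C) (f : U -> U -> C) (g : W -> W -> C) B :
  scalar (fun A => tdot f g A B).
Proof.
move=> a x y; rewrite /tdot; do 4![rewrite mulr_sumr -big_split; apply: eq_bigr => ? _ /=].
by rewrite !mxE; ring.
Qed.

Lemma tdot_conj_linear (U W : vectType C) (f : U -> U -> C) (g : W -> W -> C) A :
  scalar (fun B => conjC (tdot f g A B)).
Proof.
move=> a x y; rewrite /tdot; do 4![rewrite !rmorph_sum mulr_sumr -big_split; apply: eq_bigr => ? _ /=].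
by rewrite !mxE !(rmorphM, rmorphD) /= !conjCK; ring.
Qed.

(** Both sides are linear in A; the same argument in B reduces the claim to
    elementary tensors. *)
Lemma tdot_herm (U W : vectType C) (f : {dot U for conjC}) (g : {dot W for conjC}) A B :
  tdot f g A B = conjC (tdot f g B A).
Proof.
have hc (X : vectType C) (h : {dot X for conjC}) x y : h x y = conjC (h y x).
  by rewrite (hermC h) expr0 mul1r.
apply: (tensor_ext (Z := C^o) (tdot_linear f g B) (tdot_conj_linear f g B)) => u w.
transitivity (conjC (conjC (tdot f g (ox u w) B))); first by rewrite conjCK.
congr conjC.
apply: (tensor_ext (Z := C^o) (tdot_conj_linear f g _) (tdot_linear f g _)) => u' w'.
by rewrite !tdotE rmorphM /= -!hc.
Qed.

Variables (V : vectType C) (f : {dot V for conjC}).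
Variable e : 'I_(\dim {:V}) -> V.
Hypothesis oe : orthonormal_basis f e.

Lemma onb_expand u : u = \sum_i f u (e i) *: e i.
Proof.
pose b := [tuple e i | i < \dim {:V}].
have be (i : 'I_(\dim {:V})) : b`_i = e i by rewrite -tnth_nth tnth_mktuple.
have fb : free b.
  apply/freeP => k E i.
  have := congr1 (f^~ (e i)) E; rewrite linear_sumlz linear0l.
  rewrite (bigD1 i) //= be linearZl_LR /= oe eqxx mulr1 big1 ?addr0 // => j ji.
  by rewrite be linearZl_LR /= oe (negbTE ji) mulr0.
have bb : basis_of fullv b by rewrite basisEfree fb subvf size_tuple leqnn.
have E := coord_basis bb (memvf u).
rewrite {1}E; apply: eq_bigr => i _; rewrite be; congr (_ *: _).
rewrite [in RHS]E linear_sumlz (bigD1 i) //= be linearZl_LR /= oe eqxx mulr1 big1 ?addr0 // => j ji.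
by rewrite be linearZl_LR /= oe (negbTE ji) mulr0.
Qed.

Lemma tensor_expand z :
  z = \sum_i \sum_j tdot f f z (ox (e i) (e j)) *: ox (e i) (e j).
Proof.
pose h y : tensor V V := \sum_i \sum_j tdot f f y (ox (e i) (e j)) *: ox (e i) (e j).
have gl : linear (@id (tensor V V)) by [].
have hl : linear h.
  move=> a x y; rewrite /h.
  rewrite scaler_sumr -big_split; apply: eq_bigr => i _ /=.
  rewrite scaler_sumr -big_split; apply: eq_bigr => j _ /=.
  by rewrite (tdot_linear f f _ a x y) scalerDl scalerA.
apply: (tensor_ext gl hl) => u v.
rewrite {1}(onb_expand u) (lf_sum (ox_linear_l v)); apply: eq_bigr => i _.
rewrite {1}(onb_expand v) (lf_sum (@ox_linear_r _ _ _ _)); apply: eq_bigr => j _.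
by rewrite tdotE (lfZ (@ox_linear_r _ _ _ _)) (lfZ (ox_linear_l _)) scalerA mulrC.
Qed.
End TensorDot.

(** * The R-matrix inside the Cuntz algebra *)

Section Theta.
Variable R : realType.
Local Notation C := R[i].
Variables (V : vectType C) (f : {dot V for conjC}).
Local Notation d := (\dim {:V}).
Variable e : 'I_d -> V.
Hypothesis oe : orthonormal_basis f e.
Variables (A : cstarAlg R) (S : 'I_d -> A).
Hypothesis SS : forall i j, star (S i) * S j = (i == j)%:R.
Hypothesis Ssum : \sum_i S i * star (S i) = 1.

(** The Hilbert space V, and V ox V below, realised by isometries in the Cuntz
    algebra: star (theta u) * theta v is an inner product. *)
Definition theta1 (v : V) : A := \sum_i f v (e i) *: S i.
Definition theta2 (z : tensor V V) : A :=
  \sum_i \sum_j tdot f f z (ox (e i) (e j)) *: (S i * S j).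

Lemma theta1_linear : linear theta1.
Proof.
move=> a x y; rewrite /theta1 scaler_sumr -big_split; apply: eq_bigr => i _ /=.
by rewrite linearPl scalerDl scalerA.
Qed.

Lemma theta2_linear : linear theta2.
Proof.
move=> a x y; rewrite /theta2 scaler_sumr -big_split; apply: eq_bigr => i _ /=.
rewrite scaler_sumr -big_split; apply: eq_bigr => j _ /=.
by rewrite (tdot_linear f f _ a x y) scalerDl scalerA.
Qed.

Lemma theta1_e i : theta1 (e i) = S i.
Proof.
rewrite /theta1 (bigD1 i) //= oe eqxx scale1r big1 ?addr0 // => j ji.
by rewrite oe eq_sym (negbTE ji) scale0r.
Qed.

Lemma theta2_ox u v : theta2 (ox u v) = theta1 u * theta1 v.
Proof.
rewrite /theta2 /theta1 mulr_suml; apply: eq_bigr => i _; rewrite mulr_sumr.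
by apply: eq_bigr => j _; rewrite tdotE -scalerAl -scalerAr scalerA.
Qed.

Lemma theta1_dot u v : star (theta1 u) * theta1 v = (f v u)%:A.
Proof.
rewrite [u in LHS](onb_expand oe) [v in LHS](onb_expand oe) !(lf_sum theta1_linear).
rewrite star_sum [in RHS](onb_expand oe u) [in RHS](onb_expand oe v).
rewrite linear_sumlz scaler_suml mulr_sumr; apply: eq_bigr => i _.
rewrite linear_sumr scaler_suml mulr_suml; apply: eq_bigr => j _.
rewrite !(lfZ theta1_linear) !theta1_e starZ -scalerAl -scalerAr scalerA SS.
rewrite linearZl_LR linearZr_LR /= oe eq_sym -scaler_nat scalerA.
by congr (_ *: _); ring.
Qed.

Lemma theta2_dot y z : star (theta2 y) * theta2 z = (tdot f f z y)%:A.
Proof.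
move: z; apply: tensor_ext => [a z z'|a z z'|u v].
- by rewrite theta2_linear mulrDr -scalerAr.
- by rewrite (tdot_linear f f _ a z z') scalerDl scalerA.
rewrite -[LHS]starK starM starK; have -> : (tdot f f (ox u v) y)%:A =
  star ((tdot f f y (ox u v))%:A : A) by rewrite starZ star1 tdot_herm.
congr star; move: y; apply: tensor_ext => [a z z'|a z z'|u' v'].
- by rewrite theta2_linear mulrDr -scalerAr.
- by rewrite (tdot_linear f f _ a z z') scalerDl scalerA.
rewrite !theta2_ox starM mulrA -(mulrA (star (theta1 v))) theta1_dot.
by rewrite -scalerAr mulr1 -scalerAl theta1_dot scalerA tdotE.
Qed.

Lemma theta2_inj y z : theta2 y = theta2 z -> y = z.
Proof.
move=> E; rewrite (tensor_expand oe y) (tensor_expand oe z); apply: eq_bigr => i _.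
apply: eq_bigr => j _; congr (_ *: _).
have := theta2_dot (ox (e i) (e j)) y; rewrite E theta2_dot => /eqP.
by rewrite -subr_eq0 -scalerBl scaler_eq0 oner_eq0 orbF subr_eq0 => /eqP.
Qed.

(** The products S i * S j form a unitary row, so they can be cancelled on the
    right. *)
Lemma wd2_eq x y : (forall i j, x * (S i * S j) = y * (S i * S j)) -> x = y.
Proof.
move=> E; rewrite -[x]mulr1 -[y]mulr1 -(wsum_mon Ssum 2) !wsum_mull.
apply: eq_wsum => -[|i [|j []]] // _.
by rewrite /mon !wd_cons wd0 mulr1 !mulrA -!(mulrA _ (S i)) E.
Qed.

Variable T : 'End(tensor V V).
Hypothesis Tunit : unitary (tdot f f) (tdot f f) T.
Hypothesis Tinv : involutiveR T.

Lemma involutiveRK z : T (T z) = z.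
Proof. by have := congr1 (fun g : 'End(_) => g z) Tinv; rewrite /= comp_lfunE id_lfunE. Qed.

Lemma involutive_selfadj x y : tdot f f (T x) y = tdot f f x (T y).
Proof. by rewrite -{1}(involutiveRK y) Tunit.1. Qed.

Local Notation r := (cuntz_elem f e S T).

Lemma cuntz_elem_basis k l : r * (S k * S l) = theta2 (T (ox (e k) (e l))).
Proof.
rewrite /cuntz_elem /theta2 mulr_suml; apply: eq_bigr => i _.
rewrite mulr_suml; apply: eq_bigr => j _; rewrite mulr_suml (bigD1 k) //=.
have sm k' l' : star (S k' * S l') * (S k * S l) = ((k' == k) && (l' == l))%:R.
  rewrite starM mulrA -(mulrA (star (S l'))) SS.
  by case: (k' == k); rewrite ?mulr1 ?SS // mulr0 mul0r.
rewrite [X in _ + X]big1 ?addr0 => [|k' kk]; last first.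
  rewrite mulr_suml big1 // => l' _.
  by rewrite -scalerAl -(mulrA (S i * S j)) sm (negbTE kk) mulr0 scaler0.
rewrite mulr_suml (bigD1 l) //= [X in _ + X]big1 ?addr0 => [|l' ll].
  by rewrite -scalerAl -(mulrA (S i * S j)) sm !eqxx mulr1.
by rewrite -scalerAl -(mulrA (S i * S j)) sm (negbTE ll) andbF mulr0 scaler0.
Qed.

(** Left multiplication by the element attached to T is T itself under
    [theta2]; all the identities for that element come from this one. *)
Lemma cuntz_elem_theta2 z : r * theta2 z = theta2 (T z).
Proof.
rewrite {1}(tensor_expand oe z) {2}(tensor_expand oe z) !(lf_sum theta2_linear).
rewrite (lf_sum (lfun_linear T)) mulr_sumr (lf_sum theta2_linear).
apply: eq_bigr => i _; rewrite !(lf_sum theta2_linear) (lf_sum (lfun_linear T)).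
rewrite mulr_sumr (lf_sum theta2_linear); apply: eq_bigr => j _.
rewrite (lfZ (lfun_linear T)) !(lfZ theta2_linear) -scalerAr theta2_ox !theta1_e.
by rewrite cuntz_elem_basis.
Qed.

Lemma cuntz_elem_khom : khom S 2 2 r.
Proof.
rewrite /cuntz_elem; do 4! [apply: mspan_sum => ?]; apply: mspan_scale.
set k := (X in star (S X * _)); set l := (X in star (_ * S X)).
set i := (X in S X * _ * _); set j := (X in _ * S X * _).
have -> : S i * S j * star (S k * S l) = mon S [:: i; j] [:: k; l].
  by rewrite /mon !wd_cons wd0 !mulr1.
exact: mspan_mon.
Qed.

Lemma cuntz_elemK : r * r = 1.
Proof.
apply: wd2_eq => i j; rewrite -mulrA mul1r cuntz_elem_basis cuntz_elem_theta2 involutiveRK theta2_ox.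
by rewrite !theta1_e.
Qed.

Lemma star_cuntz_elem : star r = r.
Proof.
have H u v : star (theta2 u) * star r * theta2 v = star (theta2 u) * r * theta2 v.
  by rewrite -starM cuntz_elem_theta2 theta2_dot -mulrA cuntz_elem_theta2 theta2_dot involutive_selfadj.
have K x : (forall u, star (theta2 u) * x = 0) -> x = 0.
  move=> E; rewrite -[x]mul1r -(wsum_mon Ssum 2) wsum_mulr -[RHS](wsum0 d _ 2).
  apply: eq_wsum => -[|i [|j []]] // _.
  have := E (ox (e i) (e j)); rewrite theta2_ox !theta1_e => E'.
  by rewrite /mon !wd_cons wd0 mulr1 -!mulrA (mulrA (S i)) E' mulr0.
apply: wd2_eq => i j; apply/eqP; rewrite -subr_eq0; apply/eqP; apply: K => u.
by rewrite mulrBr !mulrA -!theta1_e -!(mulrA _ (theta1 _)) -theta2_ox H subrr.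
Qed.

Variable w : A -> C.
Hypothesis wlin : scalar w.
Hypothesis wmon : forall s t, w (mon S s t) = (s == t)%:R * d%:R ^- size s.

Variable a : A.
Hypothesis ha : khom S 1 1 a.
Hypothesis a_star : star a = a.
Hypothesis ra : r * a * r = phi S a.

Lemma phi_S x k : phi S x * S k = S k * x.
Proof.
rewrite /phi mulr_suml (bigD1 k) //= -mulrA SS eqxx mulr1 big1 ?addr0 // => i ik.
by rewrite -mulrA SS (negbTE ik) mulr0.
Qed.

Lemma intertwiner_of_element : exists X : 'End(V),
  (forall v, theta1 (X v) = a * theta1 v).
Proof.
pose g v := \sum_i \sum_k (f v (e k) * w (star (S i) * a * S k)) *: e i.
have gl : linear g.
  move=> c x y; rewrite /g scaler_sumr -big_split; apply: eq_bigr => i _ /=.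
  rewrite scaler_sumr -big_split; apply: eq_bigr => k _ /=.
  by rewrite linearPl mulrDl scalerDl scalerA mulrA.
pose g' : {linear V -> V} := HB.pack g (GRing.isLinear.Build _ _ _ _ g gl).
exists (linfun g') => v; rewrite lfunE /= /g (lf_sum theta1_linear).
rewrite [theta1 v]/theta1 mulr_sumr.
have E k : a * S k = \sum_i w (star (S i) * a * S k) *: S i.
  have /= := khom_col SS Ssum wlin wmon (t := [:: k]) ha erefl.
  rewrite wd_cons wd0 mulr1 => ->; apply: eq_bigr => i _.
  by rewrite wd_cons wd0 mulr1.
under [RHS]eq_bigr => k _ do rewrite -scalerAr E scaler_sumr.
rewrite [RHS]exchange_big; apply: eq_bigr => i _; rewrite (lf_sum theta1_linear).
by apply: eq_bigr => k _; rewrite (lfZ theta1_linear) theta1_e scalerA.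
Qed.

(** Under [theta2], left multiplication by a is X ox 1 and by phi a is 1 ox X, so
    that the relation between a and the element attached to T becomes one between
    X and T. *)
Lemma intertwiner_exists : (forall c, a <> c%:A) -> exists X : 'End(V),
  [/\ forall u v, f (X u) v = f u (X v),
      forall z, tmap X id (T z) = T (tmap id X z) &
      forall c, ~ forall v, X v = c *: v].
Proof.
move=> anc; have [X hX] := intertwiner_of_element; exists X; split.
- move=> u v; have : (f (X u) v)%:A = (f u (X v))%:A :> A.
    by rewrite -!theta1_dot !hX starM a_star mulrA.
  by move/eqP; rewrite -subr_eq0 -scalerBl scaler_eq0 oner_eq0 orbF subr_eq0 => /eqP.
- move=> z; apply: theta2_inj; rewrite -cuntz_elem_theta2.
  have lX := lfun_linear X; have li := @id_linear _ V.
  have E1 y : theta2 (tmap X id y) = a * theta2 y.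
    move: y; apply: tensor_ext => [c x y|c x y|u v].
    + by rewrite (tmap_linear _ _) theta2_linear.
    + by rewrite theta2_linear mulrDr -scalerAr.
    by rewrite tmapE // !theta2_ox hX mulrA.
  have E2 y : theta2 (tmap id X y) = phi S a * theta2 y.
    move: y; apply: tensor_ext => [c x y|c x y|u v].
    + by rewrite (tmap_linear _ _) theta2_linear.
    + by rewrite theta2_linear mulrDr -scalerAr.
    rewrite tmapE // !theta2_ox hX !mulrA; congr (_ * _).
    rewrite {1}/theta1 mulr_suml [theta1 u]/theta1 mulr_sumr.
    by apply: eq_bigr => i _; rewrite -scalerAl -scalerAr phi_S.
  by rewrite E1 E2 -ra -cuntz_elem_theta2 !mulrA cuntz_elemK mul1r.
move=> c E; apply: (anc c); rewrite -[LHS]mulr1 -Ssum mulr_sumr scaler_sumr.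
apply: eq_bigr => i _; rewrite mulrA -theta1_e -hX E (lfZ theta1_linear).
by rewrite -scalerAl.
Qed.
End Theta.

(** * Reducibility gives an intertwiner *)

Section Irreducible.
Variable R : realType.
Local Notation C := R[i].
Variables (V : vectType C) (f : {dot V for conjC}) (T : 'End(tensor V V)).
Local Notation d := (\dim {:V}).
Hypothesis d_gt1 : (1 < d)%N.
Hypothesis Tunit : unitary (tdot f f) (tdot f f) T.
Hypothesis Tinv : involutiveR T.

(** The solutions form a subspace closed under star, and a is a combination of
    the self-adjoint solutions a + star a and i (star a - a). *)
Lemma scalar_of_selfadj (A : cstarAlg R) (S : 'I_d -> A) (r : A) :
  (forall i j, star (S i) * S j = (i == j)%:R) -> star r = r ->
  (forall a, khom S 1 1 a -> star a = a -> r * a * r = phi S a -> exists c, a = c%:A) ->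
  forall a, khom S 1 1 a -> r * a * r = phi S a -> exists c, a = c%:A.
Proof.
move=> SS rs H a ha ra; have hs := khom_star ha.
have rsa : r * star a * r = phi S (star a) by rewrite -star_phi -ra !starM rs mulrA.
have phl : linear (phi S).
  move=> c x y; rewrite /phi scaler_sumr -big_split; apply: eq_bigr => i _ /=.
  by rewrite mulrDr mulrDl -scalerAr -scalerAl.
have lc c : khom S 1 1 (c *: a + star a) by apply: mspan_add => //; apply: mspan_scale.
have rl c : r * (c *: a + star a) * r = phi S (c *: a + star a).
  by rewrite phl mulrDr mulrDl -scalerAr -scalerAl ra rsa.
have [c1 E1] : exists c, 1 *: a + star a = c%:A.
  by apply: H => //; rewrite scale1r starD starK addrC.
have [c2 E2] : exists c, 'i *: (-1 *: a + star a) = c%:A :> A.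
  apply: H; first by apply: mspan_scale; exact: (lc (-1)).
    rewrite starZ starD starZ starK rmorphN1 conjCi !scaleN1r scaleNr -scalerN opprD opprK.
    by rewrite addrC.
  by rewrite -scalerAr -scalerAl rl (lfZ phl).
exists ((c1 + 'i * c2) / 2).
have : 2 *: a = (c1 + 'i * c2)%:A.
  rewrite scalerDl -scalerA -E1 -E2 scalerA -expr2 sqrCi scalerDr scalerA mulrN1 opprK.
  by rewrite scaleN1r addrACA subrr addr0 !scale1r -mulr2n scaler_nat.
by move/(congr1 (fun x => 2^-1 *: x)); rewrite !scalerA mulVf ?pnatr_eq0 // scale1r mulrC.
Qed.

(** Only the values of the normal extension at the generators matter: an operator
    commuting with its range commutes with the images of the r S_i.  Conversely a
    scalar commutes with every linear operator. *)
Lemma cuntz_scalar_ops (e : 'I_d -> V) (G : cuntz_gns R d)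
    (h : (gnsH G -> gnsH G) -> (gnsH G -> gnsH G)) :
  orthonormal_basis f e -> normal_extension f e T h ->
  (forall a, khom (@gen R d G) 1 1 a -> cuntz_elem f e (@gen R d G) T * a * cuntz_elem f e (@gen R d G) T = phi (@gen R d G) a -> exists c, a = c%:A) ->
  (commutant (h @` @gnsM R d G) `&` @gnsM R d G = @scalar_ops R (gnsH G))%classic.
Proof.
move=> oe [[hM _ _ _ _] _ [lam [lams lamS] hlam]] Hirr.
have [SS Ssum Sgen] := genP G.
have [rep cyc ip_om] := gnsP G.
have wmon s t : ip (gnsH G) (gns_pi (mon (@gen R d G) s t) (gnsOmega G)) (gnsOmega G) =
    (s == t)%:R / d%:R ^+ size s.
  by rewrite ip_om; apply: (gauge_state_mon SS Ssum (tauP G)) (E0P G); apply: ltnW.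
have piM' x : @gnsM R d G (gns_pi x).
  split; first exact: pi_bounded.
  by move=> Y [_ hY]; symmetry; apply: hY; exists x.
apply/seteqP; split=> [X [[bX cX] [_ XM]]|X [c ->]].
  apply: (commutant_scalar SS Ssum Sgen d_gt1 rep cyc wmon (cuntz_elem_khom f e (@gen R d G) T)
     (star_cuntz_elem oe SS Ssum Tunit Tinv) (cuntz_elemK oe SS Ssum Tinv)) => //.
  - by move=> Y bY cY; apply: XM; split=> // _ [x _ <-]; apply: cY.
  - move=> i; rewrite -lamS -hlam; apply: cX; exists (gns_pi (gen G i)) => //.
have bc : bounded_op (fun v : gnsH G => c *: v).
  split; first by move=> a u v; rewrite scalerDr !scalerA mulrC.
  by exists `|c| => v; rewrite normrZ.
have comm (Y : gnsH G -> gnsH G) : linear Y -> (fun v : gnsH G => c *: v) \o Y = Y \o (fun v => c *: v).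
  by move=> Yl; apply/funext => v /=; rewrite (lfZ Yl).
split; first by split=> // _ [Y MY <-]; apply: comm; have [[]] := hM _ MY.
by split=> // Y [[Yl _] _]; apply: comm.
Qed.

Theorem reducible_intertwiner : reducible f T -> exists X : 'End(V),
  [/\ forall u v, f (X u) v = f u (X v),
      forall z, tmap X id (T z) = T (tmap id X z) &
      forall c, ~ forall v, X v = c *: v].
Proof.
move=> Tred; apply: contrapT => H; apply: Tred => e G h oe hext.
have [SS Ssum _] := genP G.
apply: (cuntz_scalar_ops oe hext); apply: scalar_of_selfadj => //.
  exact: (star_cuntz_elem oe SS Ssum Tunit Tinv).
have [rep cyc ip_om] := gnsP G.
have wlin' := wlin (gnsOmega G) rep.
have wmon s t : ip (gnsH G) (gns_pi (mon (@gen R d G) s t) (gnsOmega G)) (gnsOmega G) =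
    (s == t)%:R / d%:R ^+ size s.
  by rewrite ip_om; apply: (gauge_state_mon SS Ssum (tauP G)) (E0P G); apply: ltnW.
move=> a ha sa ra; apply: contrapT => na; apply: H.
apply: (intertwiner_exists oe SS Ssum Tinv wlin' wmon ha sa ra) => c E.
by apply: na; exists c.
Qed.
End Irreducible.

(** * Tensor products of maps *)

Lemma braid_transport (X Y : Type) (i : X -> Y) (s1 s2 : X -> X) (t1 t2 : Y -> Y) :
  injective i -> (forall x, i (s1 x) = t1 (i x)) -> (forall x, i (s2 x) = t2 (i x)) ->
  t1 \o t2 \o t1 = t2 \o t1 \o t2 -> s1 \o s2 \o s1 = s2 \o s1 \o s2.
Proof.
move=> iI h1 h2 E; apply/funext => x; apply: iI; rewrite /= h1 h2 h1 h2 h1 h2.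
exact: (congr1 (@^~ (i x)) E).
Qed.

Section TensorMaps.
Variable F : fieldType.

Lemma tmap_comp (U U' U'' W W' W'' : vectType F) (g' : U' -> U'') (g : U -> U')
    (h' : W' -> W'') (h : W -> W') : linear g' -> linear g -> linear h' -> linear h ->
  forall z, tmap g' h' (tmap g h z) = tmap (g' \o g) (h' \o h) z.
Proof.
move=> lg' lg lh' lh; apply: tensor_ext; last first.
- by move=> u w; rewrite !tmapE //; apply: linear_cmp.
- exact: tmap_linear.
- exact: (linear_cmp (tmap_linear _ _) (tmap_linear _ _)).
Qed.

Lemma eq_tmap (U U' W W' : vectType F) (g g' : U -> U') (h h' : W -> W') z :
  g =1 g' -> h =1 h' -> tmap g h z = tmap g' h' z.
Proof. by move=> /funext -> /funext ->. Qed.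

Lemma tmap_id (U W : vectType F) (z : tensor U W) : tmap id id z = z.
Proof.
apply: (tensor_ext (h := id)) z => //; first exact: tmap_linear.
by move=> u w; rewrite tmapE.
Qed.

Lemma tmap_suml (U W : vectType F) (g h : U -> U) : linear g -> linear h ->
  (forall u, g u + h u = u) ->
  forall z : tensor U W, tmap g id z + tmap h id z = z.
Proof.
move=> gl hl E; have il := @id_linear _ W.
have Gl : linear (fun z : tensor U W => tmap g id z + tmap h id z).
  move=> a x y; rewrite (tmap_linear g id a x y) (tmap_linear h id a x y).
  by rewrite scalerDr addrACA.
apply: (tensor_ext Gl (@id_linear _ _)) => u w.
by rewrite (tmapE gl il) (tmapE hl il) -(lfD (ox_linear_l w)) E.
Qed.

Lemma tmap_sumr (U W : vectType F) (g h : W -> W) : linear g -> linear h ->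
  (forall w, g w + h w = w) ->
  forall z : tensor U W, tmap id g z + tmap id h z = z.
Proof.
move=> gl hl E; have il := @id_linear _ U.
have Gl : linear (fun z : tensor U W => tmap id g z + tmap id h z).
  move=> a x y; rewrite (tmap_linear id g a x y) (tmap_linear id h a x y).
  by rewrite scalerDr addrACA.
apply: (tensor_ext Gl (@id_linear _ _)) => u w.
by rewrite (tmapE il gl) (tmapE il hl) -(lfD (@ox_linear_r _ _ _ u)) E.
Qed.

Lemma tassoc_linear (U V W : vectType F) : linear (@tassoc F U V W).
Proof. exact: tlift_linear. Qed.
Lemma tassoc_inv_linear (U V W : vectType F) : linear (@tassoc_inv F U V W).
Proof. exact: tlift_linear. Qed.

Lemma tensor3_ext (U V W : vectType F) (Z : lmodType F)
    (g h : tensor (tensor U V) W -> Z) : linear g -> linear h ->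
  (forall u v w, g (ox (ox u v) w) = h (ox (ox u v) w)) -> g =1 h.
Proof.
move=> gl hl E; apply: tensor_ext => // y w; move: y; apply: tensor_ext => //.
- by move=> a x y; rewrite (ox_linear_l w) gl.
- by move=> a x y; rewrite (ox_linear_l w) hl.
Qed.

Lemma tensor3_ext' (U V W : vectType F) (Z : lmodType F)
    (g h : tensor U (tensor V W) -> Z) : linear g -> linear h ->
  (forall u v w, g (ox u (ox v w)) = h (ox u (ox v w))) -> g =1 h.
Proof.
move=> gl hl E; apply: tensor_ext => // u y; move: y; apply: tensor_ext => //.
- by move=> a x y; rewrite (@ox_linear_r _ _ _ u) gl.
- by move=> a x y; rewrite (@ox_linear_r _ _ _ u) hl.
Qed.
End TensorMaps.

(** * Kernel and image of a self-adjoint endomorphism *)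

Section Spectral.
Variable R : realType.
Local Notation C := R[i].
Variables (V : vectType C) (f : {dot V for conjC}).

Lemma exists_eigenvector (X : 'End(V)) : (0 < \dim {:V})%N ->
  exists a : C, exists2 v, v != 0 & X v = a *: v.
Proof.
move=> d0; have eb := vbasisP {:V}.
have [a ha] := eigenvalue_closed (passmx.mxof (vbasis {:V}) (vbasis {:V}) X) d0.
exists a; have := passmx.leigenspaceE eb X a => E.
have : passmx.leigenspace X a != 0%VS.
  by rewrite E passmx.vsof_eq0.
move=> W0; exists (vpick (passmx.leigenspace X a)); first by rewrite vpick0.
have := memv_pick (passmx.leigenspace X a).
rewrite memv_ker add_lfunE opp_lfunE scale_lfunE id_lfunE subr_eq0 => /eqP //.
Qed.

Variables (Y : 'End(V)).
Hypothesis Ysa : forall u v, f (Y u) v = f u (Y v).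
Local Notation W := (lker Y).
Local Notation W' := (orthov f (lker Y)).

Lemma img_orthov u : Y u \in W'.
Proof.
apply/mem_orthovP => v; rewrite memv_ker => /eqP E.
by apply: etrans (Ysa u v) _; rewrite E linear0r.
Qed.

Lemma cap_orthov (W0 : {vspace V}) : (W0 :&: orthov f W0 = 0)%VS.
Proof.
apply/eqP; rewrite -subv0; apply/subvP => v; rewrite memv_cap => /andP[vW /mem_orthovP /(_ v vW)].
by move/eqP; rewrite dnorm_eq0 memv0.
Qed.

(** The image is orthogonal to the kernel, and their dimensions are complementary. *)
Lemma ker_img_full : (W + limg Y = fullv)%VS.
Proof.
apply/eqP; rewrite eqEdim subvf /= -(limg_ker_dim Y fullv) capfv.
rewrite dimv_disjoint_sum //; apply/eqP; rewrite -subv0 -(cap_orthov W).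
apply/subvP => v; rewrite !memv_cap => /andP[-> /memv_imgP[u _ ->]] /=.
exact: img_orthov.
Qed.

Lemma orthov_img u : u \in W' -> exists u0, u = Y u0.
Proof.
move=> uW'; have : u \in (W + limg Y)%VS by rewrite ker_img_full memvf.
case/memv_addP => w wW [y /memv_imgP[u0 _ yE] uE]; exists u0.
suff w0 : w = 0 by rewrite uE w0 add0r.
have : w \in (W :&: W')%VS.
  by rewrite memv_cap wW (_ : w = u - Y u0) ?rpredB // ?img_orthov // uE yE addrK.
by rewrite cap_orthov memv0 => /eqP.
Qed.

Lemma add_orthov : (W + W' = fullv)%VS.
Proof.
apply/eqP; rewrite eqEsubv subvf /= -ker_img_full addvS //.
by apply/subvP => v /memv_imgP[u _ ->]; exact: img_orthov.
Qed.
End Spectral.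

(** * Restriction of T to the corners *)

Section Corner.
Variable R : realType.
Local Notation C := R[i].
Variables (V : vectType C) (f : {dot V for conjC}) (T : 'End(tensor V V)).
Hypothesis Tunit : unitary (tdot f f) (tdot f f) T.
Hypothesis Tyb : yang_baxter T.
Hypothesis Tinv : involutiveR T.

(** T moves the projection P onto A from the second tensor factor to the first:
    (P ox 1) T = T (1 ox P). *)
Definition moved_proj (A : {vspace V}) (P : 'End(V)) : Prop :=
  [/\ forall x, P x \in A, forall x, x \in A -> P x = x &
      forall z, tmap P id (T z) = T (tmap id P z)].

Section Proj.
Variables (A : {vspace V}) (P : 'End(V)).
Hypothesis AP : moved_proj A P.

(** As T is its own inverse, it moves P back as well. *)
Lemma moved_left z : tmap id P (T z) = T (tmap P id z).
Proof.
by have [_ _ h] := AP; rewrite -[LHS](involutiveRK Tinv) -h (involutiveRK Tinv).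
Qed.

Definition corner_proj (x : V) : subvs_of A := vsproj A (P x).

Lemma corner_proj_linear : linear corner_proj.
Proof. by move=> a x y; rewrite /corner_proj !linearP. Qed.
Lemma val_corner_proj x : vsval (corner_proj x) = P x.
Proof. by have [h _ _] := AP; apply: vsprojK. Qed.
Lemma corner_projK (x : subvs_of A) : corner_proj (vsval x) = x.
Proof. have [_ h _] := AP.
by apply: etrans (congr1 (vsproj A) (h _ (subvsP x))) _; apply: vsvalK. Qed.
End Proj.

Lemma vsval_linear (A : {vspace V}) : linear (@vsval _ _ A).
Proof. by move=> a x y; rewrite linearP. Qed.

Section Block.
Variables (A B : {vspace V}) (PA PB : 'End(V)).
Hypothesis hA : moved_proj A PA.
Hypothesis hB : moved_proj B PB.

Local Notation tproj A PA B PB := (tmap (@corner_proj A PA) (@corner_proj B PB)).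

Lemma tincl_linear (A' B' : {vspace V}) : linear (@tincl R V A' B').
Proof. exact: tmap_linear. Qed.

Lemma tinclK x : tproj A PA B PB (@tincl R V A B x) = x.
Proof.
rewrite /tincl (tmap_comp (@corner_proj_linear _ _) (@vsval_linear _)
  (@corner_proj_linear _ _) (@vsval_linear _)) -[RHS]tmap_id.
by apply: eq_tmap => y; [exact: (corner_projK hA)|exact: (corner_projK hB)].
Qed.

Lemma tincl_inj : injective (@tincl R V A B).
Proof. exact: can_inj tinclK. Qed.

Lemma tincl_proj z : tincl (tproj A PA B PB z) = tmap PA PB z.
Proof.
rewrite /tincl (tmap_comp (@vsval_linear _) (@corner_proj_linear _ _)
  (@vsval_linear _) (@corner_proj_linear _ _)).
by apply: eq_tmap => y; [exact: (val_corner_proj hA)|exact: (val_corner_proj hB)].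
Qed.

Lemma moved_both z : tmap PB PA (T z) = T (tmap PA PB z).
Proof.
have lA := lfun_linear PA; have lB := lfun_linear PB; have li := @id_linear _ V.
have E y : tmap PB PA y = tmap PB id (tmap id PA y) by rewrite tmap_comp.
have E' y : tmap PA PB y = tmap id PB (tmap PA id y) by rewrite tmap_comp.
by have [_ _ h] := hB; rewrite E (moved_left hA) E' h.
Qed.

(** The restriction of T to A ox B, with values in B ox A by [moved_both].  The
    compression by the projections makes it a map between the abstract tensor
    products. *)
Definition block_fun (x : tensor (subvs_of A) (subvs_of B)) :
    tensor (subvs_of B) (subvs_of A) :=
  tproj B PB A PA (T (tincl x)).

Lemma block_fun_linear : linear block_fun.
Proof.
exact: (linear_cmp (tmap_linear _ _) (linear_cmp (lfun_linear T) (@tincl_linear _ _))).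
Qed.

HB.instance Definition _ := GRing.isLinear.Build C _ _ _ block_fun block_fun_linear.

Definition block : 'Hom(tensor (subvs_of A) (subvs_of B), tensor (subvs_of B) (subvs_of A)) :=
  linfun block_fun.
End Block.

Section BlockE.
Variables (A B : {vspace V}) (PA PB : 'End(V)).
Hypothesis hA : moved_proj A PA.
Hypothesis hB : moved_proj B PB.

Lemma tincl_block x : tincl (block A B PA PB x) = T (tincl x) :> tensor V V.
Proof.
rewrite lfunE /= /block_fun (tincl_proj hB hA) (moved_both hA hB).
by rewrite -(tincl_proj hA hB) (tinclK hA hB).
Qed.
End BlockE.

Lemma blockK A B PA PB (hA : moved_proj A PA) (hB : moved_proj B PB) :
  cancel (block A B PA PB) (block B A PB PA).
Proof.
move=> x; apply: (tincl_inj hA hB).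
by rewrite (tincl_block hB hA) (tincl_block hA hB) (involutiveRK Tinv).
Qed.

(** The restricted forms are plain functions, so both sides are expanded on the
    reference bases of A and B. *)
Lemma tdot_tincl (A B : {vspace V}) (x y : tensor (subvs_of A) (subvs_of B)) :
  tdot (subform f (W := A)) (subform f (W := B)) x y = tdot f f (tincl x) (tincl y).
Proof.
have xl := @tincl_linear A B; have Tl z := tdot_linear f f z.
have Tcl z := tdot_conj_linear f f z.
have tE i j : tincl (ox (rbase i) (rbase j) : tensor (subvs_of A) (subvs_of B)) =
    ox (vsval (rbase i)) (vsval (rbase j)).
  by rewrite /tincl (tmapE (@vsval_linear A) (@vsval_linear B)).
have exp z : tincl z = \sum_i \sum_j (z : tensor (subvs_of A) (subvs_of B)) i j *:
    ox (vsval (rbase i)) (vsval (rbase j)).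
  rewrite [in LHS](tensor_sum z) (lf_sum xl); apply: eq_bigr => i _.
  by rewrite (lf_sum xl); apply: eq_bigr => j _; rewrite (lfZ xl) tE.
have cexp z : tdot f f z (tincl y) = \sum_k \sum_l
    conjC (y k l) * tdot f f z (ox (vsval (rbase k)) (vsval (rbase l))).
  rewrite tdot_herm (exp y) (sf_sum (Tl z)) rmorph_sum; apply: eq_bigr => k _.
  rewrite (sf_sum (Tl z)) rmorph_sum; apply: eq_bigr => l _.
  by rewrite (sfZ (Tl z)) rmorphM /= -(tdot_herm f f).
rewrite (exp x) (sf_sum (Tl _)); apply: eq_bigr => i _.
rewrite (sf_sum (Tl _)); apply: eq_bigr => j _; rewrite (sfZ (Tl _)) cexp mulr_sumr.
apply: eq_bigr => k _; rewrite mulr_sumr; apply: eq_bigr => l _.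
by rewrite tdotE [RHS]mulrA.
Qed.

Lemma block_unitary A B PA PB : moved_proj A PA -> moved_proj B PB ->
  unitary (tdot (subform f (W := A)) (subform f (W := B)))
          (tdot (subform f (W := B)) (subform f (W := A))) (block A B PA PB).
Proof.
move=> hA hB; split=> [x x'|y].
  by rewrite !tdot_tincl !(tincl_block hA hB) Tunit.1.
by exists (block B A PB PA y); apply: blockK.
Qed.

Lemma block_inv A B PA PB : moved_proj A PA -> moved_proj B PB ->
  (block A B PA PB)^-1%VF = block B A PB PA.
Proof.
move=> hA hB; apply/lfunP => y; rewrite -{1}(blockK hB hA y).
rewrite lker0_lfunK; first by [].
by apply/lker0P; exact: can_inj (blockK hA hB).
Qed.

Lemma block_involutive A PA : moved_proj A PA -> involutiveR (block A A PA PA).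
Proof.
by move=> hA; apply/lfunP => y; rewrite comp_lfunE id_lfunE; apply: blockK.
Qed.

Lemma block_yang_baxter A PA : moved_proj A PA -> yang_baxter (block A A PA PA).
Proof.
move=> hA; set S := block A A PA PA; rewrite /yang_baxter.
pose U := subvs_of A; pose io := @tincl R V A A.
have vl := @vsval_linear A; have il : linear io := @tincl_linear A A.
have pl := @corner_proj_linear A PA.
pose i3 : tensor (tensor U U) U -> tensor (tensor V V) V := tmap io vsval.
pose i3' : tensor U (tensor U U) -> tensor V (tensor V V) := tmap vsval io.
have i3l : linear i3 := tmap_linear io vsval.
have i3'l : linear i3' := tmap_linear vsval io.
have i3I : injective i3.
  apply: (can_inj (g := tmap (tmap (@corner_proj A PA) (@corner_proj A PA)) (@corner_proj A PA))).
  move=> x; rewrite /i3 (tmap_comp (tmap_linear _ _) il pl vl) -[RHS]tmap_id.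
  by apply: eq_tmap => y; [exact: (tinclK hA hA)|exact: (corner_projK hA)].
have Sio y : io (S y) = T (io y) by apply: (tincl_block hA hA).
have Sl : linear S by exact: lfun_linear.
have Tl : linear T by exact: lfun_linear.
have idU : linear (@id U) by exact: id_linear.
have idV : linear (@id V) by exact: id_linear.
have h12 x : i3 (tmap S id x) = tmap T id (i3 x).
  rewrite /i3 (tmap_comp il Sl vl idU) (tmap_comp Tl il idV vl).
  by apply: eq_tmap => y; [exact: Sio|].
have ioE (u v : U) : io (ox u v) = ox (vsval u) (vsval v) by rewrite /io /tincl (tmapE vl vl).
have ha x : i3' (tassoc x) = tassoc (i3 x).
  move: x; apply: (tensor3_ext (linear_cmp i3'l (@tassoc_linear _ _ _ _))
    (linear_cmp (@tassoc_linear _ _ _ _) i3l)) => u v w /=.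
  by rewrite tassocE /i3 /i3' (tmapE vl il) (tmapE il vl) !ioE tassocE.
have hi x : i3 (tassoc_inv x) = tassoc_inv (i3' x).
  move: x; apply: (tensor3_ext' (linear_cmp i3l (@tassoc_inv_linear _ _ _ _))
    (linear_cmp (@tassoc_inv_linear _ _ _ _) i3'l)) => u v w /=.
  by rewrite tassoc_invE /i3 /i3' (tmapE vl il) (tmapE il vl) !ioE tassoc_invE.
have h23' x : i3' (tmap id S x) = tmap id T (i3' x).
  rewrite /i3' (tmap_comp vl idU il Sl) (tmap_comp idV vl Tl il).
  by apply: eq_tmap => y; [|exact: Sio].
have h23 x : i3 ((@tassoc_inv _ U U U \o tmap id S \o @tassoc _ U U U) x) =
    (@tassoc_inv _ V V V \o tmap id T \o @tassoc _ V V V) (i3 x).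
  exact: etrans (hi _) (congr1 _ (etrans (h23' _) (congr1 _ (ha _)))).
exact: (braid_transport i3I h12 h23 Tyb).
Qed.

Lemma block_Rmatrix A PA : moved_proj A PA -> Rmatrix (subform f (W := A)) (block A A PA PA).
Proof. by move=> hA; split; [exact: block_unitary|exact: block_yang_baxter]. Qed.

Lemma mem_subtensor (A B : {vspace V}) u v : u \in A -> v \in B -> ox u v \in subtensor A B.
Proof.
move=> uA vB; rewrite (coord_vbasis uA) (lf_sum (ox_linear_l v)).
apply: memv_suml => i _; rewrite (lfZ (ox_linear_l v)); apply: memvZ.
rewrite (coord_vbasis vB) (lf_sum (@ox_linear_r _ _ _ _)).
apply: memv_suml => j _; rewrite (lfZ (@ox_linear_r _ _ _ _)); apply: memvZ.
by apply: memv_span; apply: allpairs_f; apply: mem_nth; rewrite size_tuple.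
Qed.

Lemma tincl_subtensor (A B : {vspace V}) x : @tincl R V A B x \in subtensor A B.
Proof.
rewrite (tensor_sum x) (lf_sum (@tincl_linear A B)); apply: memv_suml => i _.
rewrite (lf_sum (@tincl_linear A B)); apply: memv_suml => j _.
rewrite (lfZ (@tincl_linear A B)); apply: memvZ.
rewrite /tincl (tmapE (@vsval_linear A) (@vsval_linear B)).
by apply: mem_subtensor; exact: subvsP.
Qed.

Lemma moved_stable A PA : moved_proj A PA -> (T @: subtensor A A <= subtensor A A)%VS.
Proof.
move=> hA; rewrite limg_span; apply/span_subvP => _ /mapP[_ /allpairsP[[u v] /= [uA vA ->]] ->].
have -> : ox u v = tincl (ox (vsproj A u) (vsproj A v)).
  rewrite /tincl (tmapE (@vsval_linear A) (@vsval_linear A)).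
  by rewrite (vsprojK (vbasis_mem uA)) (vsprojK (vbasis_mem vA)).
by rewrite -(tincl_block hA hA) tincl_subtensor.
Qed.
End Corner.

(** * From an intertwiner to a moved projection *)

Section FromIntertwiner.
Variable F : fieldType.
Variables (V : vectType F) (T : 'End(tensor V V)) (Y : 'End(V)).
Hypothesis YT : forall z, tmap Y id (T z) = T (tmap id Y z).
Variables P Q : 'End(V).
Hypothesis PQ : forall x, P x + Q x = x.
Hypothesis PY : forall x, P (Y x) = 0.
Hypothesis YP : forall x, Y (P x) = 0.
Hypothesis Qimg : forall x, exists x0, Q x = Y x0.

Let Yl : linear Y. Proof. exact: lfun_linear. Qed.
Let Pl : linear P. Proof. exact: lfun_linear. Qed.
Let Ql : linear Q. Proof. exact: lfun_linear. Qed.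
Let Tl : linear T. Proof. exact: lfun_linear. Qed.
Let li : linear (@id V). Proof. exact: id_linear. Qed.

(** Q kills the kernel of Y, so it factors through Y; any right inverse of Y on
    its image provides the factor. *)
Lemma Q_factor (Pid : forall x, Y x = 0 -> P x = x) x : Q x = Q ((Y^-1)%VF (Y x)).
Proof.
have h y : Y y = 0 -> Q y = 0.
  by move=> y0; apply: (addrI (P y)); rewrite PQ addr0 Pid.
apply/eqP; rewrite -subr_eq0 -(lfB Ql); apply/eqP; apply: h.
by rewrite (lfB Yl) limg_lfunVK ?memv_img ?memvf // subrr.
Qed.

Hypothesis Pid : forall x, Y x = 0 -> P x = x.

(** After factoring Q through Y, move Y across T, where it kills P u. *)
Lemma TY_ker v u : tmap Q id (T (ox v (P u))) = 0.
Proof.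
pose Z x := Q ((Y^-1)%VF x).
have Zl : linear Z by move=> a x y; rewrite /Z !linearP.
have -> : tmap Q id (T (ox v (P u))) = tmap Z id (tmap Y id (T (ox v (P u)))).
  by rewrite (tmap_comp Zl Yl li li); apply: eq_tmap => // x; apply: Q_factor.
rewrite YT (tmapE li Yl) YP (lf0 (@ox_linear_r _ _ _ v)) (lf0 Tl).
exact: (lf0 (tmap_linear _ _)).
Qed.

(** Q u is in the image of Y; move Y across T, where it is killed by P. *)
Lemma TY_orth v u : tmap P id (T (ox v (Q u))) = 0.
Proof.
have [u0 ->] := Qimg u; rewrite -(tmapE li Yl) -YT (tmap_comp Pl Yl li li).
have E : P \o Y =1 (fun=> 0) by move=> x; exact: PY.
rewrite (eq_tmap _ E (fun _ => erefl _)).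
have l0 : linear (fun _ : V => 0 : V) by move=> a x y; rewrite scaler0 addr0.
have l0' : linear (fun _ : tensor V V => 0 : tensor V V) by move=> a x y; rewrite scaler0 addr0.
move: (T _); apply: (tensor_ext (tmap_linear _ _) l0') => x y.
by rewrite (tmapE l0 li); exact: (lf0 (ox_linear_l y)).
Qed.

Lemma P_moved z : tmap P id (T z) = T (tmap id P z).
Proof.
have D := @tmap_suml _ V V _ _ Pl Ql PQ.
move: z; apply: tensor_ext.
- exact: (linear_cmp (tmap_linear _ _) Tl).
- exact: (linear_cmp Tl (tmap_linear _ _)).
move=> v u /=; rewrite (tmapE li Pl).
have E1 : T (ox v u) = T (ox v (P u)) + T (ox v (Q u)).
  by rewrite -(lfD Tl) -(lfD (@ox_linear_r _ _ _ v)) PQ.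
have E2 : tmap P id (T (ox v u)) = tmap P id (T (ox v (P u))).
  by rewrite E1 (lfD (tmap_linear P id)) TY_orth addr0.
by have := D (T (ox v (P u))); rewrite TY_ker addr0 E2.
Qed.

Lemma Q_moved z : tmap Q id (T z) = T (tmap id Q z).
Proof.
have D := @tmap_suml _ V V _ _ Pl Ql PQ; have D' := @tmap_sumr _ V V _ _ Pl Ql PQ.
apply: (addrI (tmap P id (T z))).
by apply: etrans (D _) _; rewrite P_moved -(lfD Tl) D'.
Qed.
End FromIntertwiner.

Section Main.
Variable R : realType.
Local Notation C := R[i].
Variables (V : vectType C) (f : {dot V for conjC}) (T : 'End(tensor V V)).

Lemma moved_projections (Y : 'End(V)) :
  (forall u v, f (Y u) v = f u (Y v)) ->
  (forall z, tmap Y id (T z) = T (tmap id Y z)) ->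
  exists P Q : 'End(V), moved_proj T (lker Y) P /\ moved_proj T (orthov f (lker Y)) Q.
Proof.
move=> Ysa YT; set W := lker Y; set W' := orthov f W.
have cap0 : (W :&: W' = 0)%VS := cap_orthov f W.
have [P [Q [PW Pid QW Qid PQ]]] : exists P Q : 'End(V), [/\ forall x, P x \in W,
    forall x, x \in W -> P x = x, forall x, Q x \in W', forall x, x \in W' -> Q x = x &
    forall x, P x + Q x = x].
  exists (daddv_pi W W'), (daddv_pi W' W); split=> x.
  - exact: memv_pi.
  - exact: daddv_pi_id.
  - exact: memv_pi.
  - by apply: daddv_pi_id; rewrite capvC.
  - by apply: daddv_pi_add; rewrite // /W' (add_orthov Ysa) memvf.
have PY x : P (Y x) = 0.
  by apply: (addIr (Q (Y x))); rewrite PQ add0r Qid // (img_orthov Ysa).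
have YP x : Y (P x) = 0 by apply/eqP; rewrite -memv_ker PW.
have Qimg x : exists x0, Q x = Y x0 by apply: (orthov_img Ysa); exact: QW.
have Pid' x : Y x = 0 -> P x = x by move=> Yx; apply: Pid; rewrite memv_ker Yx.
exists P, Q; split; split=> //.
  exact: (P_moved YT PQ PY YP Qimg Pid').
exact: (Q_moved YT PQ PY YP Qimg Pid').
Qed.

(** Y is X minus one of its eigenvalues, which is real since X is self-adjoint.
    Its kernel is not V because X is not scalar. *)
Lemma selfadj_kernel (X : 'End(V)) : (0 < \dim {:V})%N ->
  (forall u v, f (X u) v = f u (X v)) ->
  (forall z, tmap X id (T z) = T (tmap id X z)) ->
  (forall c, ~ forall v, X v = c *: v) ->
  exists Y : 'End(V), [/\ forall u v, f (Y u) v = f u (Y v),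
    forall z, tmap Y id (T z) = T (tmap id Y z) & nontrivial (lker Y)].
Proof.
move=> d0 Xsa XT Xns; have [a [v v0 Xv]] := exists_eigenvector X d0.
have ar : conjC a = a.
  have := Xsa v v; rewrite Xv linearZl_LR linearZr_LR /= => /eqP.
  rewrite -subr_eq0 -mulrBl mulf_eq0 dnorm_eq0 (negbTE v0) orbF subr_eq0 => /eqP E.
  exact: esym E.
pose Y : 'End(V) := X - a *: \1%VF.
have YE u : Y u = X u - a *: u.
  by rewrite add_lfunE opp_lfunE scale_lfunE id_lfunE.
have Xl := lfun_linear X; have Yl := lfun_linear Y; have li := @id_linear _ V.
have Tl := lfun_linear T; clearbody Y.
exists Y; split.
- by move=> u w; rewrite !YE linearBl linearBr /= linearZl_LR linearZr_LR /= ar Xsa.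
- have Gl (g : tensor V V -> tensor V V) : linear g -> linear (fun z => g z - a *: z).
    move=> gl c x y; rewrite gl scalerDr opprD addrACA.
    by rewrite scalerBr !scalerA (mulrC a).
  have E1 : tmap Y id =1 (fun z : tensor V V => tmap X id z - a *: z).
    apply: (tensor_ext (tmap_linear Y id) (Gl _ (tmap_linear X id))) => u w /=.
    by rewrite (tmapE Yl li) (tmapE Xl li) YE (lfB (ox_linear_l w)) (lfZ (ox_linear_l w)).
  have E2 : tmap id Y =1 (fun z : tensor V V => tmap id X z - a *: z).
    apply: (tensor_ext (tmap_linear id Y) (Gl _ (tmap_linear id X))) => u w /=.
    by rewrite (tmapE li Yl) (tmapE li Xl) YE (lfB (@ox_linear_r _ _ _ u)) (lfZ (@ox_linear_r _ _ _ u)).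
  by move=> z; rewrite E1 E2 (lfB Tl) (lfZ Tl) XT.
split=> E.
  have : v \in lker Y by rewrite memv_ker YE Xv subrr.
  by rewrite E memv0 (negbTE v0).
apply: (Xns a) => u; have : u \in lker Y by rewrite E memvf.
by rewrite memv_ker YE subr_eq0 => /eqP.
Qed.
End Main.

Unset Implicit Arguments.

Theorem lemma6p8 (R : realType) (V : vectType R[i]) (f : {dot V for conjC})
    (T : 'End(tensor V V)) :
  (2 <= \dim {:V})%N ->
  Rmatrix f T -> involutiveR T -> reducible f T ->
  restrictable f T /\
  exists W : {vspace V},
    nontrivial W /\
    exists (S1 : 'End(tensor (subvs_of W) (subvs_of W)))
           (T1 : 'End(tensor (subvs_of (orthov f W)) (subvs_of (orthov f W))))
           (U : 'Hom(tensor (subvs_of W) (subvs_of (orthov f W)),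
                     tensor (subvs_of (orthov f W)) (subvs_of W))),
      [/\ block_form T S1 T1 U,
          unitary (tdot (subform f (W := W)) (subform f (W := orthov f W)))
                  (tdot (subform f (W := orthov f W)) (subform f (W := W))) U,
          Rmatrix (subform f (W := W)) S1 /\ involutiveR S1 &
          Rmatrix (subform f (W := orthov f W)) T1 /\ involutiveR T1].
Proof.
move=> d2 [Tunit Tyb] Tinv Tred.
have [X [Xsa XT Xns]] := reducible_intertwiner d2 Tunit Tinv Tred.
have [Y [Ysa YT Ynt]] := selfadj_kernel (ltnW d2) Xsa XT Xns.
have [P [Q [mP mQ]]] := moved_projections Ysa YT.
split; first by exists (lker Y); split; [|exact: (moved_stable Tinv mP)|exact: (moved_stable Tinv mQ)].
exists (lker Y); split; first by [].
exists (block T _ _ P P), (block T _ _ Q Q), (block T _ _ P Q).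
split.
- split=> x.
  + by rewrite (tincl_block Tinv mP mP).
  + by rewrite (tincl_block Tinv mP mQ).
  + by rewrite (block_inv Tinv mP mQ) (tincl_block Tinv mQ mP).
  + by rewrite (tincl_block Tinv mQ mQ).
- exact: (block_unitary Tunit Tinv mP mQ).
- by split; [exact: (block_Rmatrix Tunit Tyb Tinv mP)|exact: (block_involutive Tinv mP)].
- by split; [exact: (block_Rmatrix Tunit Tyb Tinv mQ)|exact: (block_involutive Tinv mQ)].
Qed.
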